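(* (Algebraic Transversal Slice Theorem.) Let $w=(w_i,w_i')_{i\in I}\in\mathbb{Z}_{\ge0}^{2n}$ and $v\in\mathbb{Z}_{\ge0}^n$, and let $p\in\mathbf{E}_{v,w}$ be a point in the stratum $\mathbf{E}^\circ_{v^0,w}$ (so $v^0\le v$). Define $w^\perp=w-C_qv^0=(w_i^\perp,{w_i^\perp}')_{i\in I}$ and $v^\perp=v-v^0$, that is, $$w_i^\perp=w_i-v_i^0,\qquad {w_i^\perp}'=w_i'-v_i^0+\sum_{h:\,j-i}v_j^0,\qquad v_i^\perp=v_i-v_i^0,$$ and let $U^\perp=\mathbf{E}_{v^\perp,w^\perp}$. Then there exist Zariski open neighborhoods $U\subseteq\mathbf{E}_{v,w}$ of $p$ and $U^0\subseteq\mathbf{E}^\circ_{v^0,w}$ of $p$, and isomorphisms of varieties $$\varphi:\pi^{-1}(U)\xrightarrow{\ \cong\ }U^0\times\pi^{-1}(U^\perp),\qquad \psi:U\xrightarrow{\ \cong\ }U^0\times U^\perp,$$ such that $\psi\circ\pi=(1\times\pi)\circ\varphi$ on $\pi^{-1}(U)$. Here $\pi^{-1}(U)\subseteq\tilde{\mathcal F}_{v,w}$ and $\pi^{-1}(U^\perp)\subseteq\tilde{\mathcal F}_{v^\perp,w^\perp}$ are taken with respect to $\pi:\tilde{\mathcal F}_{v,w}\to\mathbf{E}_{v,w}$ and $\pi:\tilde{\mathcal F}_{v^\perp,w^\perp}\to\mathbf{E}_{v^\perp,w^\perp}$ respectively. One can further assume that $U$ and $U^0$ are both invariant under the natural $\mathbb{C}^*$-action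 (multiplying all entries by the same scalar). Moreover, $\psi(p)=(p,0)$, and the diagram is compatible with the stratifications in the sense that $\psi(\mathbf{E}^\circ_{u,w}\cap U)=U^0\times\mathbf{E}^\circ_{u^\perp,w^\perp}$ for each $u$ satisfying $v^0\le u\le v$, where $u^\perp=u-v^0$.
   Context: Let $\mathcal{Q}^{\rm op}$ be a finite bipartite quiver with vertex set $I=\{1,\dots,n\}=I_0\sqcup I_1$ (vertices in $I_0$ are sinks, vertices in $I_1$ are sources) and arrow set $\Omega$; $s(h),t(h)$ denote source and target of $h\in\Omega$. For vectors, $u\le v$ means $u_i\le v_i$ for all $i$. The notation $\sum_{h:\,i-j}$ means the sum over all arrows $h$ having $i$ as an endpoint, $j$ being the other endpoint. For $v\in\mathbb{Z}^n$, $C_qv=(u_i,u_i')_{i\in I}$ with $u_i=v_i$, $u_i'=v_i-\sum_{h:\,i-j}v_j$. For $w=(w_i,w_i')_{i\in I}\in\mathbb{Z}_{\ge0}^{2n}$ fix complex vector spaces $W_i,W_i'$ of dimensions $w_i,w_i'$. Put $$\mathbf{E}_w=\bigoplus_{\alpha\in I_0}\mathrm{Hom}(W'_\alpha,W_\alpha)\oplus\bigoplus_{\beta\in I_1}\mathrm{Hom}(W_\beta,W'_\beta)\oplus\bigoplus_{h\in\Omega}\mathrm{Hom}(W_{s(h)},W_{t(h)}),$$ with elements $(x_i,y_h)_{i\in I,h\in\Omega}$. Each element determines linear maps $A_\alpha=x_\alpha+\sum_{h:t(h)=\alpha}y_h:\ W'_\alpha\oplus\bigoplus_{h:t(h)=\alpha}W_{s(h)}\to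 W_\alpha$ for $\alpha\in I_0$, and $A_\beta=x_\beta\oplus\bigoplus_{h:s(h)=\beta}y_h:\ W_\beta\to W'_\beta\oplus\bigoplus_{h:s(h)=\beta}W_{t(h)}$ for $\beta\in I_1$. For $v\in\mathbb{Z}_{\ge0}^n$ define - $\mathbf{E}_{v,w}=\{(x_i,y_h)\in\mathbf{E}_w:\ \mathrm{rank}A_i\le v_i\ \forall i\in I\}$ and $\mathbf{E}^\circ_{v,w}=\{(x_i,y_h)\in\mathbf{E}_w:\ \mathrm{rank}A_i=v_i\ \forall i\in I\}$; - $\mathcal{F}_{v,w}=\{(X_i)_{i\in I}:\ \dim X_i=v_i,\ X_\alpha\subseteq W_\alpha\ (\alpha\in I_0),\ X_\beta\subseteq W'_\beta\oplus\bigoplus_{h:s(h)=\beta}X_{t(h)}\ (\beta\in I_1)\}$, where the $X_i$ are linear subspaces; - $\tilde{\mathcal F}_{v,w}=\{(x_i,y_h,X_i):\ (x_i,y_h)\in\mathbf{E}_w,\ (X_i)\in\mathcal{F}_{v,w},\ \mathrm{im}A_i\subseteq X_i\ \forall i\in I\}$; - $\pi:\tilde{\mathcal F}_{v,w}\to\mathbf{E}_{v,w}$, $(x_i,y_h,X_i)\mapsto(x_i,y_h)$. *)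

(* Defs.v *)
From HB Require Import structures.
From mathcomp Require Import all_boot all_order all_algebra.
From mathcomp Require Import boolp classical_sets reals complex mpoly.

Set Implicit Arguments.
Unset Strict Implicit.
Unset Printing Implicit Defensive.

Import Order.TTheory GRing.Theory Num.Theory.
Local Open Scope ring_scope.
Local Open Scope classical_set_scope.

(** * Varieties as spaces with functions

Varieties over an algebraically closed field are handled, as in Serre's FAC or
Kempf's "Algebraic Varieties", as sets of points endowed with a topology and,
on each open set, a notion of regular function.  [regularf X U f] concerns only
the values of [f] on [U] and is meaningful only for open [U]. *)

Record space (K : fieldType) := Space {
  pts :> Type;
  zopen : set (set pts);
  regularf : set pts -> (pts -> K) -> Prop
}.

Definition is_morphism (K : fieldType) (X Y : space K) (f : X -> Y) : Prop :=
  forall V : set Y, zopen V ->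
    zopen (f @^-1` V) /\
    forall g : Y -> K, regularf V g -> regularf (f @^-1` V) (g \o f).

Definition is_isomorphism (K : fieldType) (X Y : space K) (f : X -> Y) : Prop :=
  is_morphism f /\
  exists g : Y -> X, [/\ is_morphism g, cancel f g & cancel g f].

Section Constructions.
Variable K : fieldType.

Definition peval (J : finType) (P : {mpoly K[#|J|]}) (x : {ffun J -> K}) : K :=
  P.@[fun k => x (enum_val k)].

Definition affine_open (J : finType) (U : set {ffun J -> K}) : Prop :=
  exists S : set {mpoly K[#|J|]},
    U = [set x | exists2 P, S P & peval P x != 0].

Definition affine_regular (J : finType) (U : set {ffun J -> K})
    (f : {ffun J -> K} -> K) : Prop :=
  forall x, U x ->
    exists (P Q : {mpoly K[#|J|]}) (V : set {ffun J -> K}),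
      [/\ affine_open V, V x, V `<=` U &
          forall y, V y -> peval Q y != 0 /\ f y = peval P y / peval Q y].

Definition affsp (J : finType) : space K :=
  Space (@affine_open J) (@affine_regular J).

(** The structure induced on a subset: the induced topology, and the functions
which are locally restrictions of regular functions.  For a locally closed
subset of a variety this is its structure of (reduced) subvariety. *)

Definition sub_open (X : space K) (Z : set X) (U : set Z) : Prop :=
  exists2 V : set X, zopen V & U = (fun z : Z => val z) @^-1` V.

Definition sub_regular (X : space K) (Z : set X) (U : set Z) (f : Z -> K) :
    Prop :=
  forall z : Z, U z -> exists (V : set X) (g : X -> K),
    [/\ zopen V, V (val z), regularf V g &
        forall z' : Z, U z' -> V (val z') -> f z' = g (val z')].

Definition subsp (X : space K) (Z : set X) : space K :=
  Space (@sub_open X Z) (@sub_regular X Z).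

(** The product of two varieties.  The topology is not the product topology:
a base is given by the sets where a function [\sum_k f_k(x) g_k(y)], with
[f_k], [g_k] regular on open sets [U], [V], does not vanish; the regular
functions are locally quotients of such functions. *)

Definition tensor (X Y : space K) (U : set X) (V : set Y) (a : X * Y -> K) :
    Prop :=
  exists (m : nat) (f : 'I_m -> X -> K) (g : 'I_m -> Y -> K),
    (forall k, regularf U (f k) /\ regularf V (g k)) /\
    forall x y, U x -> V y -> a (x, y) = \sum_k f k x * g k y.

Definition prod_open (X Y : space K) (W : set (X * Y)) : Prop :=
  forall z, W z ->
    exists (U : set X) (V : set Y) (b : X * Y -> K),
      [/\ zopen U, zopen V & tensor U V b] /\
      [/\ U z.1, V z.2, b z != 0 &
          forall t, U t.1 -> V t.2 -> b t != 0 -> W t].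

Definition prod_regular (X Y : space K) (W : set (X * Y)) (f : X * Y -> K) :
    Prop :=
  forall z, W z ->
    exists (U : set X) (V : set Y) (a b : X * Y -> K),
      [/\ zopen U, zopen V, tensor U V a & tensor U V b] /\
      [/\ U z.1, V z.2, b z != 0 &
          forall t, U t.1 -> V t.2 -> b t != 0 -> W t -> f t = a t / b t].

Definition prodsp (X Y : space K) : space K :=
  Space (@prod_open X Y) (@prod_regular X Y).

Definition quotsp (X : space K) (T : Type) (q : X -> T) : space K :=
  @Space K T (fun U => zopen (q @^-1` U))
             (fun U f => regularf (q @^-1` U) (f \o q)).

(** * Products of Grassmannians

Vectors are row vectors and a matrix acts on the right, so that an
[m * n]-matrix is a linear map from ['rV_m] to ['rV_n]. *)

Definition mximage (m n : nat) (A : 'M[K]_(m, n)) : {vspace 'rV[K]_n} :=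
  limg (linfun (mulmxr A : 'rV[K]_m -> 'rV[K]_n)).

Lemma mem_mximage (m n : nat) (A : 'M[K]_(m, n)) (u : 'rV[K]_n) :
  (u \in mximage A) = (u <= A)%MS.
Proof.
apply/memv_imgP/submxP => [[x _ ->]|[x ->]].
  by exists x; rewrite lfunE.
by exists x; rewrite ?memvf // lfunE.
Qed.

Lemma dim_mximage (m n : nat) (A : 'M[K]_(m, n)) : \dim (mximage A) = \rank A.
Proof.
have eqk : lker (linfun (mulmxr A : 'rV[K]_m -> 'rV[K]_n))
           = mximage (kermx A).
  apply/vspaceP => u; rewrite memv_ker lfunE mem_mximage /=.
  by apply/eqP/sub_kermxP.
have dimrow p q (B : 'M[K]_(p, q)) : (\dim (mximage B) <= p)%N.
  have := limg_ker_dim (linfun (mulmxr B : 'rV[K]_p -> 'rV[K]_q)) fullv.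
  rewrite dimvf /dim /= mul1n -/(mximage B) => eqp.
  by rewrite -[X in (_ <= X)%N]eqp leq_addl.
have dimle p q (B : 'M[K]_(p, q)) : (\dim (mximage B) <= \rank B)%N.
  have -> : mximage B = mximage (row_base B).
    by apply/vspaceP => u; rewrite !mem_mximage (eq_row_base B).
  exact: dimrow.
apply/eqP; rewrite eqn_leq dimle /=.
have := limg_ker_dim (linfun (mulmxr A : 'rV[K]_m -> 'rV[K]_n)) fullv.
rewrite capfv eqk dimvf /dim /= mul1n -/(mximage A) => dimE.
have := dimle _ _ (kermx A); rewrite mxrank_ker => kerle.
rewrite -(leq_add2l (m - \rank A)).
apply: (@leq_trans m); first by rewrite subnK ?rank_leq_row.
by rewrite -[X in (X <= _)%N]dimE leq_add2r.
Qed.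

Definition grass (k N : nat) : Type := {X : {vspace 'rV[K]_N} | \dim X == k}.

Definition gsub (k N : nat) (X : grass k N) : {vspace 'rV[K]_N} := sval X.

Variables (I : finType) (k N : I -> nat).

Definition frame_coord : finType := {i : I & ('I_(k i) * 'I_(N i))%type}.

Definition frame_mx (e : {ffun frame_coord -> K}) (i : I) : 'M[K]_(k i, N i) :=
  \matrix_(a, b) e (Tagged (fun i => ('I_(k i) * 'I_(N i))%type) (a, b)).

Definition frames : set (affsp frame_coord) :=
  [set e | forall i, row_free (frame_mx e i)].

Lemma frame_span_subproof (e : frames) (i : I) :
  \dim (mximage (frame_mx (val e) i)) == k i.
Proof. by rewrite dim_mximage; exact: (set_valP e). Qed.

Definition frame_span (e : frames) : forall i, grass (k i) (N i) :=
  fun i => exist _ (mximage (frame_mx (val e) i)) (frame_span_subproof e i).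

(** The product of the Grassmannians [Gr(k i, N i)], with its structure of
quotient of the variety of tuples of frames by the product of the groups
[GL_(k i)].  This quotient is a Zariski-locally trivial principal bundle, so
open sets and regular functions are those whose pull-backs to frames are. *)

Definition grassmannians : space K := quotsp (X := subsp frames) frame_span.

End Constructions.

(** * Bipartite quivers *)

Record bquiver := BQuiver {
  sink : finType;
  source : finType;
  arrow : finType;
  src : arrow -> source;
  tgt : arrow -> sink
}.

Definition vert (Q : bquiver) : finType := (sink Q + source Q)%type.

Definition levec (Q : bquiver) (u v : vert Q -> nat) : Prop :=
  forall i, (u i <= v i)%N.

(** Truncated subtraction; it is meant for [levec u v]. *)

Definition subvec (Q : bquiver) (v u : vert Q -> nat) : vert Q -> nat :=
  fun i => (v i - u i)%N.

Record wvec (Q : bquiver) := WVec {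
  wdim : vert Q -> nat;
  wdim' : vert Q -> nat
}.

Definition nbrsum (Q : bquiver) (v : vert Q -> int) (i : vert Q) : int :=
  match i with
  | inl a => \sum_(h : arrow Q | tgt h == a) v (inr (src h))
  | inr b => \sum_(h : arrow Q | src h == b) v (inl (tgt h))
  end.

Definition Cq (Q : bquiver) (v : vert Q -> int) :
    (vert Q -> int) * (vert Q -> int) :=
  (v, fun i => v i - nbrsum v i).

Definition is_wperp (Q : bquiver) (w : wvec Q) (v0 : vert Q -> nat)
    (wp : wvec Q) : Prop :=
  let c := Cq (fun i => (v0 i)%:Z) in
  forall i, (wdim wp i)%:Z = (wdim w i)%:Z - c.1 i /\
            (wdim' wp i)%:Z = (wdim' w i)%:Z - c.2 i.

Section Representations.
Variables (K : fieldType) (Q : bquiver) (w : wvec Q).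

(** The entries of the [x_i] (a pair of a basis vector of [W'_i] and one of
[W_i], whatever the direction of [x_i]) and those of the [y_h]. *)

Definition xcoord : finType :=
  {i : vert Q & ('I_(wdim' w i) * 'I_(wdim w i))%type}.

Definition ycoord : finType :=
  {h : arrow Q & ('I_(wdim w (inr (src h))) * 'I_(wdim w (inl (tgt h))))%type}.

Definition Ecoord : finType := (xcoord + ycoord)%type.

Definition Ew : space K := affsp K Ecoord.

Definition xsink (e : {ffun Ecoord -> K}) (a : sink Q) :
    'M[K]_(wdim' w (inl a), wdim w (inl a)) :=
  \matrix_(r, c) e (inl (Tagged
    (fun i => ('I_(wdim' w i) * 'I_(wdim w i))%type) (r, c))).

Definition xsource (e : {ffun Ecoord -> K}) (b : source Q) :
    'M[K]_(wdim w (inr b), wdim' w (inr b)) :=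
  \matrix_(r, c) e (inl (Tagged
    (fun i => ('I_(wdim' w i) * 'I_(wdim w i))%type) (c, r))).

Definition yarrow (e : {ffun Ecoord -> K}) (h : arrow Q) :
    'M[K]_(wdim w (inr (src h)), wdim w (inl (tgt h))) :=
  \matrix_(r, c) e (inr (Tagged
    (fun h => ('I_(wdim w (inr (src h))) * 'I_(wdim w (inl (tgt h))))%type)
    (r, c))).

(** Index sets of the canonical bases of [W'_a (+) \bigoplus_(tgt h = a)
W_(src h)] and of [W'_b (+) \bigoplus_(src h = b) W_(tgt h)]. *)

Definition sink_idx (a : sink Q) : finType :=
  ('I_(wdim' w (inl a)) +
   {h : {h : arrow Q | tgt h == a} & 'I_(wdim w (inr (src (val h))))})%type.

Definition source_idx (b : source Q) : finType :=
  ('I_(wdim' w (inr b)) +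
   {h : {h : arrow Q | src h == b} & 'I_(wdim w (inl (tgt (val h))))})%type.

Lemma wdim_tgt (a : sink Q) (h : {h : arrow Q | tgt h == a}) :
  wdim w (inl a) = wdim w (inl (tgt (val h))).
Proof. by rewrite (eqP (valP h)). Qed.

Lemma wdim_src (b : source Q) (h : {h : arrow Q | src h == b}) :
  wdim w (inr b) = wdim w (inr (src (val h))).
Proof. by rewrite (eqP (valP h)). Qed.

Definition Asink (e : {ffun Ecoord -> K}) (a : sink Q) :
    'M[K]_(#|sink_idx a|, wdim w (inl a)) :=
  \matrix_(r, c)
    match enum_val r : sink_idx a with
    | inl r' => xsink e a r' c
    | inr (existT h r') => yarrow e (val h) r' (cast_ord (wdim_tgt h) c)
    end.

Definition Asource (e : {ffun Ecoord -> K}) (b : source Q) :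
    'M[K]_(wdim w (inr b), #|source_idx b|) :=
  \matrix_(r, c)
    match enum_val c : source_idx b with
    | inl c' => xsource e b r c'
    | inr (existT h c') => yarrow e (val h) (cast_ord (wdim_src h) r) c'
    end.

Definition Adom (i : vert Q) : nat :=
  match i with inl a => #|sink_idx a| | inr b => wdim w (inr b) end.

Definition Acod (i : vert Q) : nat :=
  match i with inl a => wdim w (inl a) | inr b => #|source_idx b| end.

Definition Amap (e : {ffun Ecoord -> K}) (i : vert Q) :
    'M[K]_(Adom i, Acod i) :=
  match i with inl a => Asink e a | inr b => Asource e b end.

Variable v : vert Q -> nat.

Definition Ev : set Ew := [set e | forall i, (\rank (Amap e i) <= v i)%N].

Definition Evo : set Ew := [set e | forall i, \rank (Amap e i) = v i].

(** The component in [W_(tgt h)] of a vector of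
[W'_b (+) \bigoplus_(src h = b) W_(tgt h)]. *)

Definition arrow_comp (b : source Q) (h : {h : arrow Q | src h == b})
    (u : 'rV[K]_#|source_idx b|) : 'rV[K]_(wdim w (inl (tgt (val h)))) :=
  \row_c u 0 (enum_rank (inr (Tagged
    (fun h : {h : arrow Q | src h == b} => 'I_(wdim w (inl (tgt (val h))))) c)
    : source_idx b)).

Definition Fv : set (grassmannians K v Acod) :=
  [set X : forall i, grass K (v i) (Acod i) |
   forall (b : source Q) (u : 'rV[K]_#|source_idx b|),
     u \in gsub (X (inr b)) ->
     forall h : {h : arrow Q | src h == b},
       arrow_comp h u \in gsub (X (inl (tgt (val h))))].

Definition Ft : set (prodsp Ew (grassmannians K v Acod)) :=
  [set z | Fv z.2 /\
     forall i, (mximage (Amap z.1 i) <= gsub (z.2 i))%VS].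

(** [pr_inv U] is the inverse image of [U] under the projection [pr], and
[pr U] is the map from [pr_inv U] to [U] induced by [pr]. *)

Definition pr_inv (U : set Ew) : set (prodsp Ew (grassmannians K v Acod)) :=
  Ft `&` [set z | U z.1].

Lemma pr_subproof (U : set Ew) (z : subsp (pr_inv U)) : (val z).1 \in U.
Proof. by apply: mem_set; case: (set_valP z). Qed.

Definition pr (U : set Ew) (z : subsp (pr_inv U)) : subsp U :=
  exist (fun e => e \in U) (val z).1 (pr_subproof z).

Definition open_in (Z U : set Ew) : Prop :=
  exists2 V : set Ew, zopen V & U = Z `&` V.

Definition Cstar_invariant (U : set Ew) : Prop :=
  forall (c : K) (e : {ffun Ecoord -> K}),
    c != 0 -> U e -> U [ffun j => c * e j].

End Representations.

(* Main.v *)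
Require Import Defs.
From mathcomp Require Import all_boot all_order all_algebra.
From mathcomp Require Import boolp classical_sets reals complex mpoly.

Set Implicit Arguments.
Unset Strict Implicit.
Unset Printing Implicit Defensive.

Import Order.TTheory GRing.Theory Num.Theory.
Local Open Scope ring_scope.
Local Open Scope classical_set_scope.

(** Split each [W_i] as [I_i (+) C_i], where at [p] the image of [A_i] is [I_i]
if [i] is a sink and the kernel of [A_i] is [C_i] if [i] is a source. At [p]
the map [A_i] is then concentrated in an invertible pivot block of size [v0 i],
and the condition that all pivot blocks are invertible defines a conical open
set around [p]. On this set block elimination replaces [A_i] by its Schur
complement, which has rank smaller by [v0 i].

The difficulty is that an arrow belongs to the maps of both its ends. The
elimination therefore uses only unipotent changes of basis of the spaces [W_i];
they act on the whole of [E_w] and preserve the rank of every [A_i]. In the new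
bases, whose second summands are given by [rho e], the blocks of all the [A_i]
outside the pivots fit together into one representation [slice e] of dimension
[wp], and [A_i (slice e)] is the Schur complement of the pivot in [A_i e]
([slice_reduction]). In particular the points of rank [v0] are those with
[slice e = 0].

The change of basis is determined by a matrix [lam e] that only involves the
first summands of the spaces next to [i], so it does not change when a
representation with blocks [t] outside the pivots is added to [e]; this
addition translates [slice e] by [t] ([lam_lift], [slice_lift]). Hence
subtracting the blocks [slice e] from [e] gives a point [base e] of rank [v0],
and [e |-> (base e, slice e)] is inverse to adding the blocks [t] to [e0]
([glue]). This is [psi].

For [phi], the elimination at [i] provides a projection [qmx e i] whose kernel
lies in the image of [A_i e] and which maps this image onto that of [A_i (slice
e)]. Taking images and inverse images therefore exchanges the subspaces [X_i]
that contain the image of [A_i e] with those that contain the image of [A_i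
(slice e)] ([schur_push], [schur_pull]). The projections at the two ends of an
arrow commute with the arrow component up to the image of the map at the sink,
so the incidence conditions correspond as well ([arrow_stable_push]).

All these maps are given by matrices whose entries are rational functions with
invertible denominators. To conclude that they are morphisms, one checks that
affine spaces, subspaces, products and Grassmannians satisfy Kempf's axioms, so
that a map into a subspace or a product can be tested after projection, and
that a map into a product of Grassmannians is a morphism if its values are
locally spanned by the rows of a regular matrix ([morphism_grass]). Passing to
row spaces of possibly redundant matrices avoids choosing charts on the target.
*)

(** * Spaces with functions *)

(** Kempf's axioms for a space with functions: the open sets form a topology,
the regular functions form a sheaf of algebras, and a regular function is
invertible exactly where it does not vanish. Openness and regularity are stated
in their local form because every construction at hand defines them locally. *)
Record kempf (K : fieldType) (X : Defs.space K) : Prop := Kempf {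
  kempf_openT : zopen (setT : set X);
  kempf_openI : forall U V : set X, zopen U -> zopen V -> zopen (U `&` V);
  kempf_open_local : forall U : set X,
    (forall x, U x -> exists V, [/\ zopen V, V x & V `<=` U]) -> zopen U;
  kempf_cst : forall (U : set X) c, zopen U -> regularf U (fun=> c);
  kempfD : forall (U : set X) f g, zopen U ->
    regularf U f -> regularf U g -> regularf U (fun x => f x + g x);
  kempfM : forall (U : set X) f g, zopen U ->
    regularf U f -> regularf U g -> regularf U (fun x => f x * g x);
  kempf_open_neq0 : forall (U : set X) f, zopen U -> regularf U f ->
    zopen [set x | U x /\ f x != 0];
  kempfV : forall (U : set X) f, zopen U -> regularf U f ->
    (forall x, U x -> f x != 0) -> regularf U (fun x => (f x)^-1);
  kempf_local : forall (U : set X) f, zopen U ->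
    (forall x, U x -> exists V g, [/\ zopen V, V x, regularf V g &
       forall y, U y -> V y -> f y = g y]) -> regularf U f
}.

Section KempfTheory.
Variables (K : fieldType) (X : Defs.space K).
Hypothesis kX : kempf X.

Lemma regular_eq (U V : set X) (f g : X -> K) : zopen U -> zopen V ->
  U `<=` V -> (forall x, U x -> f x = g x) -> regularf V g -> regularf U f.
Proof.
move=> oU oV UV fg rg; apply: kempf_local => // x Ux; exists V, g; split=> //.
  exact: UV.
by move=> y Uy _; apply: fg.
Qed.

Lemma regular_sub (U V : set X) (f : X -> K) : zopen U -> zopen V ->
  U `<=` V -> regularf V f -> regularf U f.
Proof. by move=> oU oV UV; apply: regular_eq. Qed.

Lemma regular_sum (U : set X) (I : Type) (r : seq I) (f : I -> X -> K) :
  zopen U -> (forall i, regularf U (f i)) ->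
  regularf U (fun x => \sum_(i <- r) f i x).
Proof.
move=> oU rf; elim: r => [|i r IHr].
  by apply: (regular_eq (V := U) (g := fun=> 0)) => //;
    [move=> x _; rewrite big_nil | apply: kempf_cst].
apply: (regular_eq (V := U) (g := fun x => f i x + \sum_(i <- r) f i x)) => //.
  by move=> x _; rewrite big_cons.
exact: kempfD.
Qed.

Lemma regular_prod (U : set X) (I : Type) (r : seq I) (f : I -> X -> K) :
  zopen U -> (forall i, regularf U (f i)) ->
  regularf U (fun x => \prod_(i <- r) f i x).
Proof.
move=> oU rf; elim: r => [|i r IHr].
  by apply: (regular_eq (V := U) (g := fun=> 1)) => //;
    [move=> x _; rewrite big_nil | apply: kempf_cst].
apply: (regular_eq (V := U) (g := fun x => f i x * \prod_(i <- r) f i x)) => //.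
  by move=> x _; rewrite big_cons.
exact: kempfM.
Qed.

Lemma regularX (U : set X) (f : X -> K) n :
  zopen U -> regularf U f -> regularf U (fun x => f x ^+ n).
Proof.
move=> oU rf; apply: (regular_eq (V := U)
  (g := fun x => \prod_(i <- iota 0 n) f x)) => //; last exact: regular_prod.
by move=> x _; rewrite big_const_seq count_predT size_iota iter_mulr_1.
Qed.

End KempfTheory.

(** * The constructions preserve the axioms *)

Section KempfConstructions.
Variable K : fieldType.

Lemma affine_openP (J : finType) (U : set {ffun J -> K}) :
  affine_open U <-> (forall x, U x -> exists P : {mpoly K[#|J|]},
    peval P x != 0 /\ forall y, peval P y != 0 -> U y).
Proof.
split=> [[S ->] x [P SP Px]|locU]; first by exists P; split=> // y; exists P.
exists [set P | forall y, peval P y != 0 -> U y].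
rewrite predeqE => x; split=> [/locU[P [Px PU]]|[P PU /PU//]]; exists P => //.
Qed.

Lemma pevalM (J : finType) (P P' : {mpoly K[#|J|]}) x :
  peval (P * P') x = peval P x * peval P' x.
Proof. exact: mevalM. Qed.

Lemma pevalD (J : finType) (P P' : {mpoly K[#|J|]}) x :
  peval (P + P') x = peval P x + peval P' x.
Proof. exact: mevalD. Qed.

Lemma pevalC (J : finType) c x : peval (c%:MP : {mpoly K[#|J|]}) x = c.
Proof. exact: mevalC. Qed.

Lemma affine_openI (J : finType) (U V : set {ffun J -> K}) :
  affine_open U -> affine_open V -> affine_open (U `&` V).
Proof.
move=> /affine_openP oU /affine_openP oV; apply/affine_openP => x [].
move=> /oU[P [Px PU]] /oV[P' [P'x P'V]]; exists (P * P').
rewrite pevalM mulf_neq0 //; split=> // y.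
by rewrite pevalM mulf_eq0 negb_or => /andP[/PU Uy /P'V Vy].
Qed.

(** Near a point a regular function is a quotient of polynomials, and the
axioms are the usual rules for computing with fractions. *)
Lemma kempf_affsp (J : finType) : kempf (affsp K J).
Proof.
split=> /=.
- apply/affine_openP => x _; exists 1%:MP; rewrite pevalC oner_eq0 //.
- exact: affine_openI.
- move=> U locU; apply/affine_openP => x /locU[V [/affine_openP oV /oV]].
  by move=> [P [Px PV]] VU; exists P; split=> // y /PV /VU.
- move=> U c oU x Ux; exists c%:MP, 1%:MP, U; split=> // y Uy.
  by rewrite !pevalC divr1 oner_eq0.
- move=> U f g oU rf rg x Ux.
  have [P [Q [V [oV Vx VU fV]]]] := rf x Ux.
  have [P' [Q' [V' [oV' V'x V'U gV]]]] := rg x Ux.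
  exists (P * Q' + P' * Q), (Q * Q'), (V `&` V'); split=> //.
  + exact: affine_openI.
  + by move=> y [/VU].
  + move=> y [/fV[Qy ->] /gV[Q'y ->]].
    by rewrite !pevalM pevalD !pevalM mulf_neq0 // addf_div.
- move=> U f g oU rf rg x Ux.
  have [P [Q [V [oV Vx VU fV]]]] := rf x Ux.
  have [P' [Q' [V' [oV' V'x V'U gV]]]] := rg x Ux.
  exists (P * P'), (Q * Q'), (V `&` V'); split=> //.
  + exact: affine_openI.
  + by move=> y [/VU].
  + move=> y [/fV[Qy ->] /gV[Q'y ->]].
    by rewrite !pevalM mulf_neq0 // mulf_div.
- move=> U f oU rf; apply/affine_openP => x [Ux fx].
  have [P [Q [V [/affine_openP oV Vx VU fV]]]] := rf x Ux.
  have [S [Sx SV]] := oV x Vx; exists (S * P); rewrite pevalM; split=> [|y].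
    rewrite mulf_neq0 //; apply: contraNneq fx => Px.
    by have [_ ->] := fV x Vx; rewrite Px mul0r.
  rewrite pevalM mulf_eq0 negb_or => /andP[/SV Vy Py]; split; first exact: VU.
  by have [Qy ->] := fV y Vy; rewrite mulf_neq0 ?invr_eq0.
- move=> U f oU rf f0 x Ux; have [P [Q [V [oV Vx VU fV]]]] := rf x Ux.
  exists Q, P, V; split=> // y Vy; have [Qy fy] := fV y Vy.
  split; last by rewrite fy invf_div.
  by apply: contraNneq (f0 y (VU y Vy)) => Py; rewrite fy Py mul0r.
- move=> U f oU locf x Ux; have [V [g [oV Vx rg fg]]] := locf x Ux.
  have [P [Q [V' [oV' V'x V'V gV]]]] := rg x Vx.
  exists P, Q, (U `&` V'); split=> //; first exact: affine_openI.
  by move=> y [Uy V'y]; rewrite fg //; [apply: gV | apply: V'V].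
Qed.

Lemma kempf_subsp (X : Defs.space K) (Z : set X) : kempf X -> kempf (subsp Z).
Proof.
move=> kX.
have oI (U V : set Z) :
    zopen (U : set (subsp Z)) -> zopen (V : set (subsp Z)) ->
    zopen (U `&` V : set (subsp Z)).
  move=> [U' oU' ->] [V' oV' ->]; exists (U' `&` V') => //.
  exact: kempf_openI.
have oloc (U : set Z) : (forall x, U x -> exists V : set (subsp Z),
    [/\ zopen V, V x & V `<=` U]) -> zopen (U : set (subsp Z)).
  move=> locU; pose U' := [set x : X | exists V : set X,
    [/\ zopen V, V x & (fun z : Z => val z) @^-1` V `<=` U]].
  exists U'.
    apply: kempf_open_local => // x [V [oV Vx VU]].
    by exists V; split=> // y Vy; exists V.
  rewrite predeqE => z; split=> [/locU[_ [[V oV ->] Vz VU]]|[V [_ Vz]]].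
    by exists V.
  exact.
split=> //=.
- by exists setT => //; apply: kempf_openT.
- move=> U c oU z Uz; exists setT, (fun=> c); split=> //.
    exact: kempf_openT.
  by apply: kempf_cst => //; apply: kempf_openT.
- move=> U f g oU rf rg z Uz.
  have [V [f' [oV Vz rf' ff']]] := rf z Uz.
  have [W [g' [oW Wz rg' gg']]] := rg z Uz.
  have oVW := kempf_openI kX oV oW.
  exists (V `&` W), (fun x => f' x + g' x); split=> //.
    by apply: kempfD => //;
      [apply: regular_sub oV _ _ | apply: regular_sub oW _ _] => // x [].
  by move=> z' Uz' [Vz' Wz']; rewrite /= ff' ?gg'.
- move=> U f g oU rf rg z Uz.
  have [V [f' [oV Vz rf' ff']]] := rf z Uz.
  have [W [g' [oW Wz rg' gg']]] := rg z Uz.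
  have oVW := kempf_openI kX oV oW.
  exists (V `&` W), (fun x => f' x * g' x); split=> //.
    by apply: kempfM => //;
      [apply: regular_sub oV _ _ | apply: regular_sub oW _ _] => // x [].
  by move=> z' Uz' [Vz' Wz']; rewrite /= ff' ?gg'.
- move=> U f oU rf; apply: oloc => z [Uz fz].
  have [V [f' [oV Vz rf' ff']]] := rf z Uz.
  exists (U `&` (fun z : Z => val z) @^-1` [set x | V x /\ f' x != 0]).
  split=> /=.
  + apply: oI => //; exists [set x | V x /\ f' x != 0] => //.
    exact: kempf_open_neq0.
  + by split=> //=; rewrite -ff'.
  + by move=> z' [Uz' [Vz' f'z']]; split=> //=; rewrite ff'.
- move=> U f oU rf f0 z Uz; have [V [f' [oV Vz rf' ff']]] := rf z Uz.
  have oV' := kempf_open_neq0 kX oV rf'.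
  exists [set x | V x /\ f' x != 0], (fun x => (f' x)^-1); split=> //.
  + by split=> //; rewrite -ff' ?f0.
  + by apply: kempfV => //;
      [apply: regular_sub rf' => // x [] | move=> x []].
  + by move=> z' Uz' [Vz' _]; rewrite /= ff'.
- move=> U f oU locf z Uz.
  have [_ [g [[V oV ->] /= Vz rg fg]]] := locf z Uz.
  have [V' [g' [oV' V'z rg' gg']]] := rg z Vz.
  have oVV := kempf_openI kX oV oV'.
  exists (V `&` V'), g'; split=> //.
    by apply: regular_sub oV' _ _ => // x [].
  by move=> z' Uz' [Vz' V'z']; rewrite fg // gg'.
Qed.

Lemma kempf_quotsp (X : Defs.space K) (T : Type) (q : X -> T) :
  (forall t, exists x, q x = t) -> kempf X -> kempf (quotsp q).
Proof.
move=> qs kX; split=> /=.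
- exact: kempf_openT.
- by move=> U V; apply: kempf_openI.
- move=> U locU; apply: kempf_open_local => // x /locU[V [oV Vx VU]].
  by exists (q @^-1` V); split=> // y /VU.
- by move=> U c oU; apply: kempf_cst.
- by move=> U f g oU rf rg; apply: kempfD.
- by move=> U f g oU rf rg; apply: kempfM.
- by move=> U f oU rf; apply: (kempf_open_neq0 kX oU rf).
- by move=> U f oU rf f0; apply: kempfV => // x; apply: f0.
- move=> U f oU locf; apply: kempf_local => // x /locf[V [g [oV Vx rg fg]]].
  by exists (q @^-1` V), (g \o q); split=> // y; apply: fg.
Qed.

Section Product.
Variables X Y : Defs.space K.
Hypotheses (kX : kempf X) (kY : kempf Y).

(** Sums and products of tensors are naturally indexed by sums and products of
index sets. *)
Lemma tensor_fin (J : finType) (U : set X) (V : set Y) (f : J -> X -> K)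
    (g : J -> Y -> K) (a : X * Y -> K) :
  (forall j, regularf U (f j)) -> (forall j, regularf V (g j)) ->
  (forall x y, U x -> V y -> a (x, y) = \sum_j f j x * g j y) ->
  tensor U V a.
Proof.
move=> rf rg aE; exists #|J|, (f \o enum_val), (g \o enum_val).
split=> [k|x y Ux Vy]; first by split; [apply: rf | apply: rg].
rewrite aE // (reindex (@enum_val J J)) //.
by apply: onW_bij; apply: enum_val_bij.
Qed.

Lemma tensor_sub (U U' : set X) (V V' : set Y) a :
  zopen U -> zopen U' -> zopen V -> zopen V' -> U' `<=` U -> V' `<=` V ->
  tensor U V a -> tensor U' V' a.
Proof.
move=> oU oU' oV oV' UU VV [m [f [g [rfg aE]]]]; exists m, f, g; split.
  by move=> k; have [rf rg] := rfg k; split;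
    [apply: regular_sub rf | apply: regular_sub rg].
by move=> x y /UU Ux /VV Vy; apply: aE.
Qed.

Lemma tensor_cst (U : set X) (V : set Y) c : zopen U -> zopen V ->
  tensor U V (fun=> c).
Proof.
move=> oU oV; apply: (@tensor_fin 'I_1 _ _ (fun _ _ => c) (fun _ _ => 1)).
- by move=> _; apply: kempf_cst.
- by move=> _; apply: kempf_cst.
- by move=> x y _ _; rewrite big_ord1 mulr1.
Qed.

Lemma tensorD (U : set X) (V : set Y) a b :
  tensor U V a -> tensor U V b -> tensor U V (fun t => a t + b t).
Proof.
move=> [m [f [g [rfg aE]]]] [m' [f' [g' [rfg' bE]]]].
apply: (@tensor_fin ('I_m + 'I_m')%type _ _
  (fun k => match k with inl k => f k | inr k => f' k end)
  (fun k => match k with inl k => g k | inr k => g' k end)).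
- by case=> k; [case: (rfg k) | case: (rfg' k)].
- by case=> k; [case: (rfg k) | case: (rfg' k)].
- by move=> x y Ux Vy; rewrite big_sumType /= aE ?bE.
Qed.

Lemma tensorM (U : set X) (V : set Y) a b : zopen U -> zopen V ->
  tensor U V a -> tensor U V b -> tensor U V (fun t => a t * b t).
Proof.
move=> oU oV [m [f [g [rfg aE]]]] [m' [f' [g' [rfg' bE]]]].
apply: (@tensor_fin ('I_m * 'I_m')%type _ _
  (fun k x => f k.1 x * f' k.2 x) (fun k y => g k.1 y * g' k.2 y)).
- by move=> [k k']; apply: kempfM => //; [case: (rfg k) | case: (rfg' k')].
- by move=> [k k']; apply: kempfM => //; [case: (rfg k) | case: (rfg' k')].
- move=> x y Ux Vy; rewrite aE ?bE // big_distrlr pair_bigA /=.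
  by apply: eq_bigr => -[k k'] _; rewrite mulrACA.
Qed.

Lemma prod_openI (W W' : set (X * Y)) :
  prod_open W -> prod_open W' -> prod_open (W `&` W').
Proof.
move=> oW oW' z [Wz W'z].
have [U [V [b [[oU oV tb] [Uz Vz bz bW]]]]] := oW z Wz.
have [U' [V' [b' [[oU' oV' tb'] [U'z V'z b'z bW']]]]] := oW' z W'z.
have oUU := kempf_openI kX oU oU'; have oVV := kempf_openI kY oV oV'.
exists (U `&` U'), (V `&` V'), (fun t => b t * b' t); split; split=> //.
- apply: tensorM => //; [apply: tensor_sub tb | apply: tensor_sub tb'] => //;
  by move=> ? [].
- by rewrite mulf_neq0.
- move=> t [Ut U't] [Vt V't]; rewrite mulf_eq0 negb_or => /andP[bt b't].
  by split; [apply: bW | apply: bW'].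
Qed.

(** Functions on a product are locally fractions with numerator and denominator
in the tensor product, so the rules for fractions apply again, inside basic
open sets which are cut out by the denominators. *)
Lemma kempf_prodsp : kempf (prodsp X Y).
Proof.
have rcst U c : prod_open U -> prod_regular U (fun _ : X * Y => c).
  move=> oU z Uz; exists setT, setT, (fun=> c), (fun=> 1).
  have oX := kempf_openT kX; have oY := kempf_openT kY.
  split; split=> //; try exact: tensor_cst.
    by rewrite oner_eq0.
  by move=> t; rewrite divr1.
split=> //=.
- move=> z _; exists setT, setT, (fun=> 1).
  have oX := kempf_openT kX; have oY := kempf_openT kY.
  by split; split=> //; [apply: tensor_cst | rewrite oner_eq0].
- exact: prod_openI.
- move=> U locU z /locU[V [oV Vz VU]].
  have [V1 [V2 [b [[oV1 oV2 tb] [V1z V2z bz bV]]]]] := oV z Vz.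
  exists V1, V2, b; split; split=> // t V1t V2t bt.
  by apply: VU; apply: bV.
- move=> W f g oW rf rg z Wz.
  have [U [V [a [b [[oU oV ta tb] [Uz Vz bz fE]]]]]] := rf z Wz.
  have [U' [V' [a' [b' [[oU' oV' ta' tb'] [U'z V'z b'z gE]]]]]] := rg z Wz.
  have oUU := kempf_openI kX oU oU'; have oVV := kempf_openI kY oV oV'.
  have sub c : tensor U V c -> tensor (U `&` U') (V `&` V') c.
    by apply: tensor_sub => // ? [].
  have sub' c : tensor U' V' c -> tensor (U `&` U') (V `&` V') c.
    by apply: tensor_sub => // ? [].
  exists (U `&` U'), (V `&` V'), (fun t => a t * b' t + a' t * b t),
    (fun t => b t * b' t); split; split=> //.
  + by apply: tensorD; apply: tensorM => //; auto.
  + by apply: tensorM => //; auto.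
  + by rewrite mulf_neq0.
  + move=> t [Ut U't] [Vt V't]; rewrite mulf_eq0 negb_or => /andP[bt b't] Wt.
    by rewrite fE // gE // addf_div.
- move=> W f g oW rf rg z Wz.
  have [U [V [a [b [[oU oV ta tb] [Uz Vz bz fE]]]]]] := rf z Wz.
  have [U' [V' [a' [b' [[oU' oV' ta' tb'] [U'z V'z b'z gE]]]]]] := rg z Wz.
  have oUU := kempf_openI kX oU oU'; have oVV := kempf_openI kY oV oV'.
  have sub c : tensor U V c -> tensor (U `&` U') (V `&` V') c.
    by apply: tensor_sub => // ? [].
  have sub' c : tensor U' V' c -> tensor (U `&` U') (V `&` V') c.
    by apply: tensor_sub => // ? [].
  exists (U `&` U'), (V `&` V'), (fun t => a t * a' t),
    (fun t => b t * b' t); split; split=> //.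
  + by apply: tensorM => //; auto.
  + by apply: tensorM => //; auto.
  + by rewrite mulf_neq0.
  + move=> t [Ut U't] [Vt V't]; rewrite mulf_eq0 negb_or => /andP[bt b't] Wt.
    by rewrite fE // gE // mulf_div.
- move=> W f oW rf z [Wz fz].
  have [U [V [a [b [[oU oV ta tb] [Uz Vz bz fE]]]]]] := rf z Wz.
  have [U' [V' [b' [[oU' oV' tb'] [U'z V'z b'z bW]]]]] := oW z Wz.
  have oUU := kempf_openI kX oU oU'; have oVV := kempf_openI kY oV oV'.
  have sub c : tensor U V c -> tensor (U `&` U') (V `&` V') c.
    by apply: tensor_sub => // ? [].
  have sub' c : tensor U' V' c -> tensor (U `&` U') (V `&` V') c.
    by apply: tensor_sub => // ? [].
  exists (U `&` U'), (V `&` V'), (fun t => (a t * b t) * b' t).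
  split; split=> //.
  + by apply: tensorM; auto; apply: tensorM; auto.
  + rewrite !mulf_neq0 //; apply: contraNneq fz => az.
    by rewrite fE // az mul0r.
  + move=> t [Ut U't] [Vt V't]; rewrite !mulf_eq0 !negb_or -andbA.
    move=> /and3P[at0 bt b't].
    have Wt : W t by apply: bW.
    by split=> //; rewrite fE // mulf_neq0 ?invr_eq0.
- move=> W f oW rf f0 z Wz.
  have [U [V [a [b [[oU oV ta tb] [Uz Vz bz fE]]]]]] := rf z Wz.
  exists U, V, (fun t => b t * b t), (fun t => a t * b t); split; split=> //.
  + by apply: tensorM.
  + by apply: tensorM.
  + rewrite mulf_neq0 //; apply: contraNneq (f0 z Wz) => az.
    by rewrite fE // az mul0r.
  + move=> t Ut Vt; rewrite mulf_eq0 negb_or => /andP[at0 bt] Wt.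
    by rewrite fE // invf_div -mulf_div divff // mulr1.
- move=> W f oW locf z Wz; have [W' [g [oW' W'z rg fg]]] := locf z Wz.
  have [U [V [a [b [[oU oV ta tb] [Uz Vz bz gE]]]]]] := rg z W'z.
  have [U' [V' [b' [[oU' oV' tb'] [U'z V'z b'z bW]]]]] := oW' z W'z.
  have oUU := kempf_openI kX oU oU'; have oVV := kempf_openI kY oV oV'.
  have sub c : tensor U V c -> tensor (U `&` U') (V `&` V') c.
    by apply: tensor_sub => // ? [].
  have sub' c : tensor U' V' c -> tensor (U `&` U') (V `&` V') c.
    by apply: tensor_sub => // ? [].
  exists (U `&` U'), (V `&` V'), (fun t => a t * b' t), (fun t => b t * b' t).
  split; split=> //.
  + by apply: tensorM; auto.
  + by apply: tensorM; auto.
  + by rewrite mulf_neq0.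
  + move=> t [Ut U't] [Vt V't]; rewrite mulf_eq0 negb_or => /andP[bt b't] Wt.
    have W't : W' t by apply: bW.
    by rewrite fg // gE // -mulf_div divff // mulr1.
Qed.

End Product.

End KempfConstructions.

(** * Morphisms *)

Section Morphisms.
Variable K : fieldType.
Implicit Types X Y Z : Defs.space K.

Lemma morphism_comp X Y Z (f : X -> Y) (g : Y -> Z) :
  is_morphism f -> is_morphism g -> is_morphism (g \o f).
Proof.
move=> mf mg V /mg[oV rV]; have [oU rU] := mf _ oV.
by split=> // h /rV /rU.
Qed.

Lemma morphism_val X (S : set X) :
  is_morphism (X := subsp S) (Y := X) (fun z => val z).
Proof. by move=> V oV; split; [exists V | move=> g rg z Vz; exists V, g]. Qed.

Lemma morphism_subsp X Y (S : set Y) (f : X -> subsp S) : kempf X ->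
  is_morphism (X := X) (Y := Y) (fun x => val (f x)) -> is_morphism f.
Proof.
move=> kX mf _ [V oV ->]; have [oU _] := mf V oV; split=> // g rg.
apply: kempf_local => // x Vx.
have [V' [g' [oV' V'x rg' gg']]] := rg (f x) Vx.
have [oU' rU'] := mf V' oV'.
exists ((fun x => val (f x)) @^-1` V'), (fun x => g' (val (f x))).
by split=> //; [apply: rU' | move=> y Vy V'y; apply: gg'].
Qed.

Lemma morphism_fst X Y : kempf X -> kempf Y ->
  is_morphism (X := prodsp X Y) (Y := X) fst.
Proof.
move=> kX kY V oV; have oY := kempf_openT kY; split=> [z Vz|g rg z Vz].
  exists V, setT, (fun=> 1).
  by split; split=> //; [apply: tensor_cst | rewrite oner_eq0].
exists V, setT, (fun t => g t.1), (fun=> 1).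
split; split=> //; try exact: tensor_cst; last 2 first.
- by rewrite oner_eq0.
- by move=> t; rewrite divr1.
apply: (tensor_fin (J := 'I_1) (f := fun=> g) (g := fun _ _ => 1)) => //.
- by move=> _; apply: kempf_cst.
- by move=> x y; rewrite big_ord1 mulr1.
Qed.

Lemma morphism_snd X Y : kempf X -> kempf Y ->
  is_morphism (X := prodsp X Y) (Y := Y) snd.
Proof.
move=> kX kY V oV; have oX := kempf_openT kX; split=> [z Vz|g rg z Vz].
  exists setT, V, (fun=> 1).
  by split; split=> //; [apply: tensor_cst | rewrite oner_eq0].
exists setT, V, (fun t => g t.2), (fun=> 1).
split; split=> //; try exact: tensor_cst; last 2 first.
- by rewrite oner_eq0.
- by move=> t; rewrite divr1.
apply: (tensor_fin (J := 'I_1) (f := fun _ _ => 1) (g := fun=> g)) => //.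
- by move=> _; apply: kempf_cst.
- by move=> x y; rewrite big_ord1 mul1r.
Qed.

(** The universal property of the product. A tensor pulls back to a sum of
products of regular functions, and both the basic open sets and the regular
functions of the product are built from tensors. *)
Lemma morphism_pair Z X Y (f : Z -> prodsp X Y) : kempf Z ->
  is_morphism (X := Z) (Y := X) (fun z => (f z).1) ->
  is_morphism (X := Z) (Y := Y) (fun z => (f z).2) -> is_morphism f.
Proof.
move=> kZ m1 m2.
have rtensor (U : set X) (V : set Y) a : zopen U -> zopen V -> tensor U V a ->
    zopen (f @^-1` [set t | U t.1 /\ V t.2]) /\
    regularf (f @^-1` [set t | U t.1 /\ V t.2]) (a \o f).
  move=> oU oV [m [g [h [rgh aE]]]].
  have [oU' rU] := m1 U oU; have [oV' rV] := m2 V oV.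
  have o := kempf_openI kZ oU' oV'; split=> //.
  apply: (regular_eq kZ (V := f @^-1` [set t | U t.1 /\ V t.2])
     (g := fun z => \sum_k g k (f z).1 * h k (f z).2)) => //.
    by move=> z [Uz Vz] /=; rewrite [f z]surjective_pairing aE.
  apply: regular_sum => // k; have [rg rh] := rgh k; apply: kempfM => //.
    by apply: (regular_sub kZ _ oU' _ (rU _ rg)) => // z [].
  by apply: (regular_sub kZ _ oV' _ (rV _ rh)) => // z [].
have opre (W : set (prodsp X Y)) : zopen W -> zopen (f @^-1` W).
  move=> oW; apply: kempf_open_local => // z Wz.
  have [U [V [b [[oU oV tb] [Uz Vz bz bW]]]]] := oW (f z) Wz.
  have [o r] := rtensor _ _ _ oU oV tb.
  exists [set z | (f @^-1` [set t | U t.1 /\ V t.2]) z /\ (b \o f) z != 0].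
  split=> //; first exact: kempf_open_neq0.
  by move=> z' [[Uz' Vz'] bz']; apply: bW.
move=> W oW; split=> [|g rg]; first exact: opre.
apply: kempf_local => //; first exact: opre.
move=> z Wz; have [U [V [a [b [[oU oV ta tb] [Uz Vz bz gE]]]]]] := rg (f z) Wz.
have [o ra] := rtensor _ _ _ oU oV ta; have [_ rb] := rtensor _ _ _ oU oV tb.
have o' := kempf_open_neq0 kZ o rb.
exists [set z | (f @^-1` [set t | U t.1 /\ V t.2]) z /\ (b \o f) z != 0].
exists (fun z => (a \o f) z * ((b \o f) z)^-1); split=> //.
- apply: kempfM => //; first by apply: (regular_sub kZ _ o _ ra) => // x [].
  apply: kempfV => //; last by move=> x [].
  by apply: (regular_sub kZ _ o _ rb) => // x [].
- by move=> y Wy [[Uy Vy] by0] /=; rewrite gE.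
Qed.

Lemma morphism_affsp Z (J : finType) (f : Z -> affsp K J) : kempf Z ->
  (forall j, regularf setT (fun z => f z j)) -> is_morphism f.
Proof.
move=> kZ rf; have oT := kempf_openT kZ.
have rP (P : {mpoly K[#|J|]}) : regularf setT (fun z => peval P (f z)).
  apply: (regular_eq kZ (V := setT) (g := fun z =>
    \sum_(m <- msupp P) P@_m * \prod_i f z (enum_val i) ^+ m i)) => //.
  apply: regular_sum => // m; apply: kempfM => //; first exact: kempf_cst.
  by apply: regular_prod => // i; apply: regularX.
have opre (V : set (affsp K J)) : zopen V -> zopen (f @^-1` V).
  move=> /affine_openP oV; apply: kempf_open_local => // z /oV[P [Pz PV]].
  exists [set z | setT z /\ peval P (f z) != 0]; split=> //.
    exact: (kempf_open_neq0 kZ oT (rP P)).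
  by move=> z' [_ /PV].
move=> V oV; split=> [|g rg]; first exact: opre.
apply: kempf_local => //; first exact: opre.
move=> z Vz; have [P [Q [W [oW Wz WV gE]]]] := rg (f z) Vz.
have oW' := opre _ oW.
exists (f @^-1` W), (fun z => peval P (f z) * (peval Q (f z))^-1); split=> //.
  apply: kempfM => //; first by apply: (regular_sub kZ _ oT _ (rP P)).
  apply: kempfV => //; first by apply: (regular_sub kZ _ oT _ (rP Q)).
  by move=> x Wx; case: (gE (f x) Wx).
by move=> y _ Wy; case: (gE (f y) Wy).
Qed.

Lemma regular_coord Z (J : finType) (f : Z -> affsp K J) j :
  is_morphism f -> regularf setT (fun z => f z j).
Proof.
move=> mf; have kA := @kempf_affsp K J.
have [_ rf] := mf setT (kempf_openT kA); apply: (rf (fun x => x j)) => x _.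
exists 'X_(enum_rank j), 1%:MP, setT; split=> //; first exact: kempf_openT kA.
by move=> y _; rewrite pevalC oner_eq0 divr1 /peval mevalXU enum_rankK.
Qed.

Lemma morphism_local X Y (f : X -> Y) : kempf X ->
  (forall x, exists O : set X, [/\ zopen O, O x &
     is_morphism (X := subsp O) (Y := Y) (fun z => f (val z))]) ->
  is_morphism f.
Proof.
move=> kX locf V oV.
have oU : zopen (f @^-1` V).
  apply: kempf_open_local => // x Vx; have [O [oO Ox mf]] := locf x.
  have [[W oW WE] _] := mf V oV; exists (O `&` W); split=> //.
  - exact: kempf_openI.
  - split=> //; have : ((fun z : O => val z) @^-1` W) (exist _ x (mem_set Ox)).
      by rewrite -WE.
    by [].
  - move=> y [Oy Wy].
    have : ((fun z : O => val z) @^-1` W) (exist _ y (mem_set Oy)) by [].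
    by rewrite -WE.
split=> // g rg; apply: kempf_local => // x Vx.
have [O [oO Ox mf]] := locf x; have [_ rf] := mf V oV.
have [W [g' [oW Wx rg' gg']]] := rf g rg (exist _ x (mem_set Ox)) Vx.
have oOW := kempf_openI kX oO oW.
exists (O `&` W), g'; split=> //.
  by apply: (regular_sub kX _ oW _ rg') => // y [].
by move=> y Vy [Oy Wy]; apply: (gg' (exist _ y (mem_set Oy))).
Qed.

End Morphisms.

(** * Matrices of regular functions *)

Section RegularMatrices.
Variables (K : fieldType) (X : Defs.space K).
Hypothesis kX : kempf X.

Definition regular_mx (U : set X) m n (F : X -> 'M[K]_(m, n)) : Prop :=
  forall i j, regularf U (fun x => F x i j).

Variable U : set X.
Hypothesis oU : zopen U.

Lemma regular_mx_eq m n (F G : X -> 'M[K]_(m, n)) :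
  (forall x, U x -> F x = G x) -> regular_mx U G -> regular_mx U F.
Proof.
move=> FG rG i j; apply: regular_eq (rG i j) => // x Ux.
by rewrite FG.
Qed.

Lemma regular_mx_sub (V : set X) m n (F : X -> 'M[K]_(m, n)) : zopen V ->
  U `<=` V -> regular_mx V F -> regular_mx U F.
Proof. by move=> oV UV rF i j; apply: regular_sub (rF i j). Qed.

Lemma regular_mx_cst m n (A : 'M[K]_(m, n)) : regular_mx U (fun=> A).
Proof. by move=> i j; apply: kempf_cst. Qed.

Lemma regular_mxD m n (F G : X -> 'M[K]_(m, n)) :
  regular_mx U F -> regular_mx U G -> regular_mx U (fun x => F x + G x).
Proof.
move=> rF rG i j; apply: regular_eq (kempfD kX oU (rF i j) (rG i j)) => // x _.
by rewrite mxE.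
Qed.

Lemma regular_mxM m n p (F : X -> 'M[K]_(m, n)) (G : X -> 'M[K]_(n, p)) :
  regular_mx U F -> regular_mx U G -> regular_mx U (fun x => F x *m G x).
Proof.
move=> rF rG i j; apply: (regular_eq kX (V := U)
  (g := fun x => \sum_l F x i l * G x l j)) => //.
  by move=> x _; rewrite mxE.
by apply: regular_sum => // l; apply: kempfM.
Qed.

Lemma regular_mxB m n (F G : X -> 'M[K]_(m, n)) :
  regular_mx U F -> regular_mx U G -> regular_mx U (fun x => F x - G x).
Proof.
move=> rF rG; apply: (regular_mx_eq (G := fun x => F x + (- 1%:M) *m G x)).
  by move=> x _; rewrite mulNmx mul1mx.
by apply: regular_mxD => //; apply: regular_mxM => //; apply: regular_mx_cst.
Qed.

Lemma regular_col_mx m1 m2 n (F : X -> 'M[K]_(m1, n)) (G : X -> 'M[K]_(m2, n)) :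
  regular_mx U F -> regular_mx U G ->
  regular_mx U (fun x => col_mx (F x) (G x)).
Proof.
move=> rF rG i j; case iE: (split i) => [a|a].
  by apply: regular_eq (rF a j) => // x _; rewrite mxE iE.
by apply: regular_eq (rG a j) => // x _; rewrite mxE iE.
Qed.

Lemma regular_det n (F : X -> 'M[K]_n) :
  regular_mx U F -> regularf U (fun x => \det (F x)).
Proof.
move=> rF; apply: regular_sum => // s; apply: kempfM => //.
  exact: kempf_cst.
by apply: regular_prod.
Qed.

Lemma regular_invmx n (F : X -> 'M[K]_n) : regular_mx U F ->
  (forall x, U x -> F x \in unitmx) -> regular_mx U (fun x => invmx (F x)).
Proof.
move=> rF uF i j; apply: (regular_eq kX (V := U)
  (g := fun x => (\det (F x))^-1 * cofactor (F x) j i)) => //.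
  by move=> x Ux; rewrite /invmx uF // !mxE.
apply: kempfM => //.
  apply: kempfV => //; first exact: regular_det.
  by move=> x /uF; rewrite unitmxE unitfE.
apply: kempfM => //; first exact: kempf_cst.
apply: regular_det => a b.
apply: (regular_eq kX (V := U) (g := fun x => F x (lift j a) (lift i b))) => //.
by move=> x _; rewrite !mxE.
Qed.

(** This is the nonvanishing locus of the product of the determinants. *)
Lemma open_unitmx (I : finType) (n : I -> nat)
    (F : forall i, X -> 'M[K]_(n i)) :
  (forall i, regular_mx U (F i)) ->
  zopen [set x | U x /\ forall i, F i x \in unitmx].
Proof.
move=> rF.
have -> : [set x | U x /\ forall i, F i x \in unitmx] =
          [set x | U x /\ \prod_i \det (F i x) != 0].
  rewrite predeqE => x; split=> -[Ux uF]; split=> //.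
    by apply/prodf_neq0 => i _; rewrite -unitfE -unitmxE.
  by move=> i; rewrite unitmxE unitfE; move/prodf_neq0: uF; apply.
apply: kempf_open_neq0 => //; apply: regular_prod => // i; exact: regular_det.
Qed.

End RegularMatrices.

(** * Grassmannians *)

Section Grassmannians.
Variable K : fieldType.

Lemma mximage_submx m1 m2 n (A : 'M[K]_(m1, n)) (B : 'M[K]_(m2, n)) :
  (mximage A <= mximage B)%VS = (A <= B)%MS.
Proof.
apply/subvP/row_subP => AB => [i|u].
  by rewrite -mem_mximage AB // mem_mximage row_sub.
rewrite !mem_mximage => /submx_trans; apply; exact/row_subP.
Qed.

Lemma mximage_eqmx m1 m2 n (A : 'M[K]_(m1, n)) (B : 'M[K]_(m2, n)) :
  (A :=: B)%MS -> mximage A = mximage B.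
Proof. by move=> AB; apply/vspaceP => u; rewrite !mem_mximage AB. Qed.

Lemma vspace_mximage n (X : {vspace 'rV[K]_n}) :
  exists F : 'M[K]_(\dim X, n), mximage F = X.
Proof.
exists (\matrix_i (vbasis X)`_i); apply/vspaceP => u; rewrite mem_mximage.
apply/idP/idP => [/submxP[c ->]|Xu].
  rewrite mulmx_sum_row; apply: memv_suml => i _; apply: memvZ.
  by rewrite rowK; apply: vbasis_mem; apply: mem_nth; rewrite size_tuple.
rewrite (coord_vbasis Xu); apply: summx_sub => i _; apply: scalemx_sub.
by apply: (eq_row_sub i); rewrite rowK.
Qed.

(** [S] selects independent combinations of the rows of [A], and [T] a minor
that detects their independence. *)
Lemma full_rank_factor m n k (A : 'M[K]_(m, n)) : \rank A = k ->
  exists (S : 'M[K]_(k, m)) (T : 'M[K]_(n, k)), S *m A *m T = 1%:M.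
Proof.
move=> <-; have /submxP[S SA] : (row_base A <= A)%MS by rewrite eq_row_base.
exists S, (pinvmx (row_base A)); rewrite -SA.
by apply: mulmxVp; apply: row_base_free.
Qed.

(** Two frames of a subspace differ by an invertible left factor, which cancels
in the reduced form [invmx (A *m T) *m A]; so this form descends from frames to
the Grassmannian. *)
Lemma reduced_frame k n (A B : 'M[K]_(k, n)) (T : 'M[K]_(n, k)) :
  row_free A -> mximage A = mximage B ->
  (A *m T \in unitmx) = (B *m T \in unitmx) /\
  (A *m T \in unitmx -> invmx (A *m T) *m A = invmx (B *m T) *m B).
Proof.
move=> fA AB.
have /submxP[D BA] : (B <= A)%MS by rewrite -mximage_submx AB.
have rB : \rank B = k by rewrite -dim_mximage -AB dim_mximage; apply/eqP.
have uD : D \in unitmx.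
  rewrite -row_full_unit /row_full eqn_leq rank_leq_row /=.
  by rewrite -{1}rB BA mxrankM_maxl.
split=> [|uA]; first by rewrite BA -mulmxA unitmx_mul uD.
have uB : B *m T \in unitmx by rewrite BA -mulmxA unitmx_mul uD.
rewrite -[LHS]mul1mx -(mulVmx uB) -mulmxA {2}BA -2!(mulmxA D).
by rewrite mulKVmx // -BA.
Qed.

Variables (I : finType) (k N : I -> nat).
Local Notation G := (grassmannians K k N).

Lemma grass_eq (X Y : G) : (forall i, gsub (X i) = gsub (Y i)) -> X = Y.
Proof.
move=> XY; apply: functional_extensionality_dep => i; apply: val_inj.
exact: XY.
Qed.

Lemma frame_span_surj (X : G) : exists e : @frames K I k N, frame_span e = X.
Proof.
have ex i : exists F : 'M[K]_(k i, N i), mximage F = gsub (X i).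
  have [F FX] := vspace_mximage (gsub (X i)); move: F FX.
  by rewrite (eqP (svalP (X i))) => F; exists F.
pose F i := projT1 (cid (ex i)).
have FX i : mximage (F i) = gsub (X i) by apply: (projT2 (cid (ex i))).
pose e : affsp K (frame_coord k N) :=
  [ffun j : frame_coord k N => F (tag j) (tagged j).1 (tagged j).2].
have eF i : frame_mx e i = F i by apply/matrixP => a b; rewrite mxE ffunE.
have fe : e \in @frames K I k N.
  apply: mem_set => i; rewrite eF /row_free -dim_mximage FX.
  exact: svalP (X i).
exists (exist _ e fe); apply: grass_eq => i.
by rewrite /gsub /frame_span /= eF FX.
Qed.

Lemma kempf_frames : kempf (subsp (@frames K I k N)).
Proof. by apply: kempf_subsp; apply: kempf_affsp. Qed.

Lemma kempf_grass : kempf G.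
Proof.
by apply: kempf_quotsp; [apply: frame_span_surj | apply: kempf_frames].
Qed.

Lemma regular_frame_mx i :
  regular_mx (X := subsp (@frames K I k N)) setT (fun e => frame_mx (val e) i).
Proof.
move=> a b; have kF := kempf_frames; have oT := kempf_openT kF.
have /(regular_coord (Tagged (fun i => ('I_(k i) * 'I_(N i))%type) (a, b))) :=
  @morphism_val _ (affsp K (frame_coord k N)) (@frames K I k N).
by apply: regular_eq => // e _; rewrite mxE.
Qed.

(** The local sections of the bundle of frames: choose [T] such that the minor
[A *m T] is invertible for a frame [A] at the given point, and reduce frames
with respect to this minor. *)
Lemma grass_local_frame (X0 : G) :
  exists (V : set G) (S : forall i, G -> 'M[K]_(k i, N i)),
  [/\ zopen V, V X0, forall i, regular_mx V (S i) &
      forall X, V X -> forall i, mximage (S i X) = gsub (X i)].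
Proof.
pose F X := val (projT1 (cid (frame_span_surj X))).
have fF X i : row_free (frame_mx (F X) i).
  exact: (set_valP (projT1 (cid (frame_span_surj X)))).
have FX X i : mximage (frame_mx (F X) i) = gsub (X i).
  have := projT2 (cid (frame_span_surj X)).
  by move=> /(congr1 (fun X => gsub (X i))).
have exT i : exists T : 'M[K]_(N i, k i), frame_mx (F X0) i *m T = 1%:M.
  by have /row_freeP[T] := fF X0 i; exists T.
pose T i := projT1 (cid (exT i)).
have FT i : frame_mx (F X0) i *m T i = 1%:M by apply: (projT2 (cid (exT i))).
have red (e : @frames K I k N) i := reduced_frame (T i) (set_valP e i)
   (esym (FX (frame_span e) i)).
have kF := kempf_frames; have oT := kempf_openT kF.
pose V : set G := [set X | forall i, frame_mx (F X) i *m T i \in unitmx].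
pose V' : set (subsp (@frames K I k N)) :=
  [set e | setT e /\ forall i, frame_mx (val e) i *m T i \in unitmx].
have rT i : regular_mx setT
    (fun e : subsp (@frames K I k N) => frame_mx (val e) i *m T i).
  apply: regular_mxM => //; first exact: regular_frame_mx.
  exact: regular_mx_cst.
have oV' : zopen V' by apply: open_unitmx.
have VE : (@frame_span K I k N) @^-1` V = V'.
  rewrite predeqE => e; split=> [Ve|[_ Ve] i].
    by split=> // i; rewrite (red e i).1; apply: Ve.
  by rewrite -(red e i).1.
exists V, (fun i X => invmx (frame_mx (F X) i *m T i) *m frame_mx (F X) i).
split.
- by rewrite /zopen /= VE.
- by move=> i; rewrite FT unitmx1.
- move=> i a b; rewrite /regularf /= VE.
  have r : regular_mx V' (fun e : subsp (@frames K I k N) =>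
      invmx (frame_mx (val e) i *m T i) *m frame_mx (val e) i).
    apply: regular_mxM => //.
      apply: regular_invmx => //; last by move=> e [_].
      exact: (regular_mx_sub kF oV' oT _ (rT i)).
    exact: (regular_mx_sub kF oV' oT _ (@regular_frame_mx i)).
  apply: (regular_eq kF oV' oV' _ _ (r a b)) => // e [_ Ve].
  by rewrite /= (red e i).2.
- move=> X VX i; rewrite -(FX X i); apply: mximage_eqmx.
  by apply: eqmxMfull; rewrite row_full_unit unitmx_inv; apply: VX.
Qed.

(** Near a given point, fixed combinations of the rows of [B i] that form a
frame there remain a frame, so the map lifts locally to frames. Allowing too
many rows matters because images and sums of subspaces come with redundant
spanning families. *)
Lemma morphism_grass (Z : Defs.space K) (f : Z -> G) : kempf Z ->
  (forall z0, exists (O : set Z) (m : I -> nat)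
      (B : forall i, Z -> 'M[K]_(m i, N i)),
    [/\ zopen O, O z0, forall i, regular_mx O (B i) &
        forall z, O z -> forall i, mximage (B i z) = gsub (f z i)]) ->
  is_morphism f.
Proof.
move=> kZ loc; apply: morphism_local => // z0.
have [O [m [B [oO Oz0 rB BE]]]] := loc z0.
have rkB z i : O z -> \rank (B i z) = k i.
  by move=> Oz; rewrite -dim_mximage BE //; apply/eqP/(svalP (f z i)).
have exS i : exists ST : 'M[K]_(k i, m i) * 'M[K]_(N i, k i),
    ST.1 *m B i z0 *m ST.2 = 1%:M.
  by have [S [T]] := full_rank_factor (rkB _ i Oz0); exists (S, T).
pose S i := (projT1 (cid (exS i))).1; pose T i := (projT1 (cid (exS i))).2.
have SBT i : S i *m B i z0 *m T i = 1%:M by apply: (projT2 (cid (exS i))).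
have rSB i : regular_mx O (fun z => S i *m B i z).
  by apply: regular_mxM => //; apply: regular_mx_cst.
have rSBT i : regular_mx O (fun z => S i *m B i z *m T i).
  by apply: regular_mxM => //; apply: regular_mx_cst.
pose O' := [set z | O z /\ forall i, S i *m B i z *m T i \in unitmx].
have oO' : zopen O' by apply: open_unitmx.
exists O'; split=> //; first by split=> // i; rewrite SBT unitmx1.
have kO' := kempf_subsp O' kZ; have oT := kempf_openT kO'.
pose e (z : O') : affsp K (frame_coord k N) := [ffun j : frame_coord k N =>
  (S (tag j) *m B (tag j) (val z)) (tagged j).1 (tagged j).2].
have eE z i : frame_mx (e z) i = S i *m B i (val z).
  by apply/matrixP => a b; rewrite mxE ffunE.
have fe z : e z \in @frames K I k N.
  apply: mem_set => i; rewrite eE /row_free eqn_leq rank_leq_row /=.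
  have [_ /(_ i)] := set_valP z; rewrite -row_full_unit => /eqP {1}<-.
  exact: mxrankM_maxl.
pose phi (z : subsp O') : subsp (@frames K I k N) := exist _ (e z) (fe z).
have mphi : is_morphism phi.
  apply: morphism_subsp => //; apply: morphism_affsp => // -[i [a b]].
  have [_ r] := @morphism_val _ Z O' _ oO'.
  have r' : regularf O' (fun z => (S i *m B i z) a b).
    by apply: (regular_sub kZ oO' oO _ (rSB i a b)) => z [].
  have oO'' := (@morphism_val _ Z O' _ oO').1.
  apply: (regular_eq kO' oT oO'' _ _ (r _ r')).
    by move=> z _; apply: set_valP z.
  by move=> z _; rewrite /= ffunE.
have -> : (fun z : subsp O' => f (val z)) = (@frame_span K I k N) \o phi.
  apply: funext => z; apply: grass_eq => i.
  have Oz : O (val z) by case: (set_valP z).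
  rewrite /gsub /= eE; apply/esym/eqP.
  rewrite -/(gsub _) -BE // eqEdim mximage_submx submxMl !dim_mximage rkB //=.
  have := set_mem (fe z) i; rewrite eE => /eqP ->; exact: leqnn.
by apply: morphism_comp mphi _ => V oV; split.
Qed.

End Grassmannians.

(** * Schur complements *)

Lemma limg_mximage (K : fieldType) (p N N' : nat) (B : 'M[K]_(p, N))
    (q : 'M[K]_(N, N')) :
  (linfun (mulmxr q : 'rV[K]_N -> 'rV[K]_N') @: mximage B)%VS =
  mximage (B *m q).
Proof.
apply/vspaceP => u; rewrite mem_mximage; apply/memv_imgP/idP => [[x]|].
  by rewrite mem_mximage => Bx ->; rewrite lfunE /= submxMr.
move=> /submxP[c ->]; exists (c *m B); first by rewrite mem_mximage submxMl.
by rewrite lfunE /= mulmxA.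
Qed.

Section Schur.
Variables (K : fieldType) (M N r M' N' : nat).
Variables (A : 'M[K]_(M, N)) (m : 'M[K]_(r, M)) (mu : 'M[K]_(N, r)).
Variables (R : 'M[K]_(M', M)) (Q : 'M[K]_(N, N')).

(** Killing the rows [m *m A] of the pivot by means of the columns [mu]; the
Schur complement of [m *m A *m mu] in the matrix of [A] with respect to [R],
[Q] is [R *m A *m schur_proj]. Working with complementary families [m], [R] and
[mu], [Q] instead of block matrices keeps the index types of [A]. *)
Definition schur_proj : 'M[K]_(N, N') :=
  Q - mu *m invmx (m *m A *m mu) *m (m *m A) *m Q.

Hypothesis a_unit : m *m A *m mu \in unitmx.
Hypothesis R_inj : forall x : 'cV[K]_M, R *m x = 0 -> m *m x = 0 -> x = 0.
Hypothesis Q_inj : forall u : 'rV[K]_N, u *m Q = 0 -> u *m mu = 0 -> u = 0.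
Hypothesis dimN : N = (r + N')%N.

Local Notation q := schur_proj.

Lemma schur_projE p (u : 'M[K]_(p, N)) :
  u *m q = (u - u *m mu *m invmx (m *m A *m mu) *m (m *m A)) *m Q.
Proof. by rewrite mulmxBr mulmxBl !mulmxA. Qed.

Lemma schur_proj0 : m *m A *m q = 0.
Proof. by rewrite schur_projE mulmxV // mul1mx subrr mul0mx. Qed.

(** If [u *m q = 0], then [u] minus its pivot part is killed by both [Q] and
[mu]. *)
Lemma schur_ker (u : 'rV[K]_N) : (u *m q == 0) = (u <= m *m A)%MS.
Proof.
apply/eqP/idP => [uq0|/submxP[c ->]]; last first.
  by rewrite -mulmxA schur_proj0 mulmx0.
suff -> : u = u *m mu *m invmx (m *m A *m mu) *m (m *m A) by apply: submxMl.
apply/eqP; rewrite -subr_eq0; apply/eqP; apply: Q_inj.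
  by rewrite -schur_projE.
by rewrite mulmxBl -!mulmxA [m *m (A *m mu)]mulmxA mulVmx // mulmx1 subrr.
Qed.

Lemma schur_rank_ker : \rank (m *m A) = r.
Proof.
apply/eqP; rewrite eqn_leq rank_leq_row /=.
have /eqP {1}<- : row_full (m *m A *m mu) by rewrite row_full_unit.
exact: mxrankM_maxl.
Qed.

Lemma schur_kermx : (kermx q :=: m *m A)%MS.
Proof.
apply/eqmxP/andP; split; last by apply/sub_kermxP; apply: schur_proj0.
apply/row_subP => i; rewrite -schur_ker; apply/eqP; apply/sub_kermxP.
exact: row_sub.
Qed.

Lemma schur_full : row_full q.
Proof.
have := mxrank_ker q; rewrite schur_kermx schur_rank_ker => rE.
have := rank_leq_row q; have := rank_leq_col q; rewrite /row_full.
by rewrite eqn_leq => -> /= le; rewrite -(leq_add2l r) -dimN {1}rE subnK.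
Qed.

(** The rows of [R] and [m] together generate, and [q] kills those of [m *m A].
*)
Lemma schur_eqmx : (A *m q :=: R *m A *m q)%MS.
Proof.
apply/eqmxP; rewrite -[X in (_ == X)%MS]mulmxA submxMl andbT.
have : row_full (col_mx R m).
  rewrite /row_full -mxrank_tr -/(row_free _) -kermx_eq0; apply/rowV0P => u.
  rewrite tr_col_mx => /sub_kermxP; rewrite mul_mx_row => /eqP.
  rewrite row_mx_eq0 => /andP[/eqP uR /eqP um].
  by apply: trmx_inj; rewrite trmx0; apply: R_inj;
    rewrite -[LHS]trmxK trmx_mul trmxK ?uR ?um trmx0.
move=> /row_fullP[S RS]; rewrite -[S]hsubmxK mul_row_col in RS.
rewrite -[X in (X <= _)%MS]mul1mx -RS mulmxDl -mulmxA addmx_sub //; last first.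
  by rewrite -mulmxA [m *m _]mulmxA schur_proj0 mulmx0 sub0mx.
exact: submxMl.
Qed.

Lemma schur_rank : \rank A = (r + \rank (R *m A *m q))%N.
Proof.
rewrite -schur_eqmx -(mxrank_mul_ker A q) addnC; congr (_ + _)%N.
rewrite -[RHS]schur_rank_ker; apply: eqmx_rank; apply/andP; split.
  by rewrite (submx_trans (capmxSr _ _)) // schur_kermx.
by rewrite sub_capmx submxMl schur_kermx submx_refl.
Qed.

Local Notation f := (linfun (mulmxr q : 'rV[K]_N -> 'rV[K]_N')).

Lemma schur_lker : lker f = mximage (m *m A).
Proof.
by apply/vspaceP => u; rewrite memv_ker lfunE mem_mximage -schur_ker.
Qed.

Lemma schur_limg : limg f = fullv.
Proof.
apply/vspaceP => u; rewrite memvf; apply/memv_imgP.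
exists (u *m pinvmx q); rewrite ?memvf // lfunE /= mulmxKpV //.
by rewrite submx_full ?schur_full.
Qed.

(** The kernel of the projection lies in the image of [A], so a subspace that
contains this image is recovered from its own image. *)
Lemma schur_push (X : {vspace 'rV[K]_N}) : (mximage A <= X)%VS ->
  [/\ \dim X = (r + \dim (f @: X))%N,
      (mximage (R *m A *m q) <= f @: X)%VS & (f @^-1: (f @: X))%VS = X].
Proof.
move=> AX; have kX : (lker f <= X)%VS.
  by apply: subv_trans AX; rewrite schur_lker mximage_submx submxMl.
split.
- rewrite -(limg_ker_dim f X); congr (_ + _)%N.
  by rewrite (capv_idPr kX) schur_lker dim_mximage schur_rank_ker.
- rewrite -(mximage_eqmx schur_eqmx) -limg_mximage; exact: limgS.
- apply/vspaceP => u; rewrite -memv_preim; apply/idP/idP => [|uX].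
    move=> /memv_imgP[x xX /eqP]; rewrite -subr_eq0 -linearB /=.
    rewrite -memv_ker => /(subvP kX) uxX.
    by rewrite -[u](subrK x) memvD.
  exact: memv_img.
Qed.

Lemma schur_pull (Y : {vspace 'rV[K]_N'}) : (mximage (R *m A *m q) <= Y)%VS ->
  [/\ \dim (f @^-1: Y) = (r + \dim Y)%N,
      (mximage A <= f @^-1: Y)%VS & (f @: (f @^-1: Y))%VS = Y].
Proof.
move=> AY; have fY : (f @: (f @^-1: Y))%VS = Y.
  by apply: lpreimK; rewrite schur_limg subvf.
have AX : (mximage A <= f @^-1: Y)%VS.
  apply/subvP => u uA; rewrite -memv_preim; apply: (subvP AY).
  by rewrite -(mximage_eqmx schur_eqmx) -limg_mximage memv_img.
by split=> //; have [-> _ _] := schur_push AX; rewrite fY.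
Qed.

End Schur.

(** * Splittings *)

(** A direct sum decomposition of a space of row vectors: the columns of [spI]
and [spC] are the coordinates along the two summands, and the rows of [spJ] are
a basis of the second one. At the sources the roles are exchanged: the columns
of [spI] and [spC] are bases, and [spJ] gives the coordinates along the second
summand. *)
Record splitting (K : fieldType) (n r n' : nat) := Splitting {
  spI : 'M[K]_(n, r);
  spC : 'M[K]_(n, n');
  spJ : 'M[K]_(n', n);
  spJC : spJ *m spC = 1%:M;
  spJI : spJ *m spI = 0;
  sp_inj : forall p (u : 'M[K]_(p, n)), u *m spI = 0 -> u *m spC = 0 -> u = 0;
  sp_dim : n = (r + n')%N
}.

(** Gaussian elimination writes [A] as a matrix with [r] columns times the
first [r] rows of an invertible matrix [U]; the summands are spanned by the
first and the last rows of [U]. *)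
Lemma splitting_exists (K : fieldType) (m n r n' : nat) (A : 'M[K]_(m, n)) :
  n = (r + n')%N -> \rank A = r ->
  exists s : splitting K n r n', A *m spC s = 0 /\ \rank (A *m spI s) = r.
Proof.
move=> nE; subst n => rA.
pose U := row_ebase A; have uU : U \in unitmx by apply: row_ebase_unit.
pose V := invmx U.
have VU : lsubmx V *m usubmx U + rsubmx V *m dsubmx U = 1%:M.
  by rewrite -mul_row_col hsubmxK vsubmxK mulVmx.
have UV : U *m V = 1%:M by rewrite mulmxV.
have UV1 := UV; rewrite -[U]vsubmxK -[V]hsubmxK mul_col_row -[1%:M]submxK in UV.
have [_ _ JI JC] := eq_block_mx UV.
have J1 : dlsubmx (1%:M : 'M[K]_(r + n')) = 0.
  by apply/matrixP => i j; rewrite !mxE eq_rlshift.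
have J2 : drsubmx (1%:M : 'M[K]_(r + n')) = 1%:M.
  by apply/matrixP => i j; rewrite !mxE eq_rshift.
have inj p (u : 'M[K]_(p, r + n')) :
    u *m lsubmx V = 0 -> u *m rsubmx V = 0 -> u = 0.
  by move=> u1 u2; rewrite -[u]mulmx1 -VU mulmxDr !mulmxA u1 u2 !mul0mx addr0.
exists (Splitting (etrans JC J2) (etrans JI J1) inj (erefl _)) => /=.
have AC : A *m rsubmx V = 0.
  rewrite -[A]mulmx_ebase rA.
  rewrite -!mulmxA -/U (_ : U *m rsubmx V = rsubmx (U *m V)); last first.
    by rewrite -[V in RHS]hsubmxK mul_mx_row row_mxKr.
  rewrite UV1 (_ : _ *m rsubmx _ = 0) ?mulmx0 //.
  apply/matrixP => i j; rewrite !mxE big1 // => l _; rewrite !mxE.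
  have [->|_] := eqVneq l (rshift r j); last by rewrite mulr0.
  have [-> |_] := eqVneq (i : nat) (rshift r j); last by rewrite mul0r.
  by rewrite /= ltnNge leq_addr mul0r.
split=> //; apply/eqP; rewrite eqn_leq rank_leq_col /= -{1}rA.
have {1}-> : A = A *m lsubmx V *m usubmx U.
  by rewrite -[LHS]mulmx1 -VU mulmxDr !mulmxA AC mul0mx addr0.
exact: mxrankM_maxl.
Qed.

(** * Matrices with star-shaped column index sets *)

(** The index set of [W'_i (+) \bigoplus_h W_j], with centre [W'_i] and one
branch for each arrow at [i]. *)
Definition star (n0 : nat) (H : finType) (n : H -> nat) : finType :=
  ('I_n0 + {h : H & 'I_(n h)})%type.

Section Star.
Variables (K : fieldType) (H : finType) (n0 : nat) (n : H -> nat).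
Local Notation S := (star n0 n).

Definition scol0 p (B : 'M[K]_(p, #|S|)) : 'M[K]_(p, n0) :=
  colsub (fun c => enum_rank (inl c : S)) B.

Definition scol (h : H) p (B : 'M[K]_(p, #|S|)) : 'M[K]_(p, n h) :=
  colsub (fun c => enum_rank (inr (Tagged (fun h => 'I_(n h)) c) : S)) B.

Definition srow p (B0 : 'M[K]_(p, n0)) (B : forall h, 'M[K]_(p, n h)) :
    'M[K]_(p, #|S|) :=
  \matrix_(r, c) match enum_val c : S with
    | inl c' => B0 r c'
    | inr (existT h c') => B h r c'
    end.

Lemma srowK0 p (B0 : 'M[K]_(p, n0)) (B : forall h, 'M[K]_(p, n h)) :
  scol0 (srow B0 B) = B0.
Proof. by apply/matrixP => r c; rewrite !mxE enum_rankK. Qed.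

Lemma srowK p (B0 : 'M[K]_(p, n0)) (B : forall h, 'M[K]_(p, n h)) h :
  scol h (srow B0 B) = B h.
Proof. by apply/matrixP => r c; rewrite !mxE enum_rankK. Qed.

Lemma scol_eq p (B C : 'M[K]_(p, #|S|)) :
  scol0 B = scol0 C -> (forall h, scol h B = scol h C) -> B = C.
Proof.
move=> BC0 BC; apply/matrixP => r c; rewrite -[c]enum_valK.
case: (enum_val c) => [c'|[h c']].
  by have /matrixP/(_ r c') := BC0; rewrite !mxE.
by have /matrixP/(_ r c') := BC h; rewrite !mxE.
Qed.

Lemma scol0M p p' (A : 'M[K]_(p', p)) (B : 'M[K]_(p, #|S|)) :
  scol0 (A *m B) = A *m scol0 B.
Proof. by rewrite /scol0 mulmx_colsub. Qed.

Lemma scolM p p' (A : 'M[K]_(p', p)) (B : 'M[K]_(p, #|S|)) h :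
  scol h (A *m B) = A *m scol h B.
Proof. by rewrite /scol mulmx_colsub. Qed.

Lemma scolD p (B C : 'M[K]_(p, #|S|)) h :
  scol h (B + C) = scol h B + scol h C.
Proof. by apply/matrixP => r c; rewrite !mxE. Qed.

Lemma scolN p (B : 'M[K]_(p, #|S|)) h : scol h (- B) = - scol h B.
Proof. by apply/matrixP => r c; rewrite !mxE. Qed.

Lemma scol0_0 p : scol0 (0 : 'M[K]_(p, #|S|)) = 0.
Proof. by apply/matrixP => r c; rewrite !mxE. Qed.

Lemma scol_0 p h : scol h (0 : 'M[K]_(p, #|S|)) = 0.
Proof. by apply/matrixP => r c; rewrite !mxE. Qed.

Lemma card_star : #|S| = (n0 + \sum_h n h)%N.
Proof.
rewrite card_sum card_ord card_tagged sumnE big_map big_enum /=.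
by congr (_ + _)%N; apply: eq_bigr => h _; rewrite card_ord.
Qed.

End Star.

Section StarDiag.
Variables (K : fieldType) (H : finType) (n0 : nat) (n k : H -> nat).

(** A block diagonal matrix, the identity in the centre and [g h] on the branch
[h], written by columns so that no branch is compared with another. *)
Definition sdiag (g : forall h, 'M[K]_(n h, k h)) :
    'M[K]_(#|star n0 n|, #|star n0 k|) :=
  srow (scol0 1%:M) (fun h => scol h 1%:M *m g h).

Lemma sdiag0 g p (B : 'M[K]_(p, #|star n0 n|)) :
  scol0 (B *m sdiag g) = scol0 B.
Proof. by rewrite scol0M srowK0 -scol0M mulmx1. Qed.

Lemma sdiagE g p (B : 'M[K]_(p, #|star n0 n|)) h :
  scol h (B *m sdiag g) = scol h B *m g h.
Proof. by rewrite scolM srowK mulmxA -scolM mulmx1. Qed.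

Variables (c : H -> nat) (g : forall h, 'M[K]_(n h, k h)).
Variables (f : forall h, 'M[K]_(n h, c h)) (k0 r : nat).
Variables (nu : 'M[K]_(#|star n0 k|, k0)) (mu : 'M[K]_(#|star n0 k|, r)).

(** Splitting each branch as [g], [f] and the star of the first summands as
[mu], [nu] splits the whole star as [sdiag g *m mu] and [star_rest]. *)
Definition star_rest : 'M[K]_(#|star n0 n|, #|star k0 c|) :=
  srow (sdiag g *m nu) (fun h => scol h 1%:M *m f h).

Lemma star_rest0 p (B : 'M[K]_(p, #|star n0 n|)) :
  scol0 (B *m star_rest) = B *m sdiag g *m nu.
Proof. by rewrite scol0M srowK0 mulmxA. Qed.

Lemma star_restE p (B : 'M[K]_(p, #|star n0 n|)) h :
  scol h (B *m star_rest) = scol h B *m f h.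
Proof. by rewrite scolM srowK mulmxA -scolM mulmx1. Qed.

Hypothesis gf_inj : forall h p (u : 'M[K]_(p, n h)),
  u *m g h = 0 -> u *m f h = 0 -> u = 0.
Hypothesis munu_inj : forall p (u : 'M[K]_(p, #|star n0 k|)),
  u *m mu = 0 -> u *m nu = 0 -> u = 0.

Lemma star_rest_inj p (u : 'M[K]_(p, #|star n0 n|)) :
  u *m star_rest = 0 -> u *m (sdiag g *m mu) = 0 -> u = 0.
Proof.
move=> uQ; rewrite mulmxA => umu.
have ug : u *m sdiag g = 0.
  by apply: munu_inj => //; rewrite -star_rest0 uQ scol0_0.
apply: scol_eq => [|h]; first by rewrite -(sdiag0 g) ug !scol0_0.
rewrite scol_0; apply: gf_inj; first by rewrite -sdiagE ug scol_0.
by rewrite -star_restE uQ scol_0.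
Qed.

End StarDiag.

(** The relation between a matrix [A], a projection [q] and the Schur
complement [A']: everything that is used of the block elimination. *)
Definition schur_reduction (K : fieldType) (r M N M' N' : nat)
    (A : 'M[K]_(M, N)) (q : 'M[K]_(N, N')) (A' : 'M[K]_(M', N')) : Prop :=
  let f := linfun (mulmxr q : 'rV[K]_N -> 'rV[K]_N') in
  [/\ row_full q, \rank A = (r + \rank A')%N,
      forall X, (mximage A <= X)%VS ->
        [/\ \dim X = (r + \dim (f @: X))%N, (mximage A' <= f @: X)%VS &
            (f @^-1: (f @: X))%VS = X] &
      forall Y, (mximage A' <= Y)%VS ->
        [/\ \dim (f @^-1: Y) = (r + \dim Y)%N, (mximage A <= f @^-1: Y)%VS &
            (f @: (f @^-1: Y))%VS = Y]].

Lemma schur_projP (K : fieldType) (M N r M' N' : nat) (A : 'M[K]_(M, N))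
    (m : 'M[K]_(r, M)) (mu : 'M[K]_(N, r)) (R : 'M[K]_(M', M))
    (Q : 'M[K]_(N, N')) :
  m *m A *m mu \in unitmx ->
  (forall x : 'cV[K]_M, R *m x = 0 -> m *m x = 0 -> x = 0) ->
  (forall u : 'rV[K]_N, u *m Q = 0 -> u *m mu = 0 -> u = 0) ->
  N = (r + N')%N ->
  schur_reduction r A (schur_proj A m mu Q) (R *m A *m schur_proj A m mu Q).
Proof.
move=> ua Ri Qi dN; split; [exact: schur_full | exact: schur_rank | |].
- by move=> X; apply: schur_push.
- by move=> Y; apply: schur_pull.
Qed.

(** * Representations at a vertex *)

Section Vertex.
Variables (K : fieldType) (Q : bquiver).

(** The arrows at a vertex, as an index set of its own, so that sinks and
sources can be treated together. *)
Definition inc (i : vert Q) : finType :=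
  match i with
  | inl a => {h : arrow Q | tgt h == a} : finType
  | inr b => {h : arrow Q | src h == b} : finType
  end.

Definition opp (i : vert Q) : inc i -> vert Q :=
  match i with
  | inl a => fun h => inr (src (val h))
  | inr b => fun h => inl (tgt (val h))
  end.

Definition at_tgt (h : arrow Q) : inc (inl (tgt h)) :=
  exist (fun h' => tgt h' == tgt h) h (eqxx _).

Definition at_src (h : arrow Q) : inc (inr (src h)) :=
  exist (fun h' => src h' == src h) h (eqxx _).

(** Every half-edge is one end of an arrow; arguing in this way makes the casts
between the dimensions at the two descriptions of a vertex trivial. *)
Lemma inc_ind (P : forall i : vert Q, inc i -> Prop) :
  (forall h, P _ (at_tgt h)) -> (forall h, P _ (at_src h)) ->
  forall i (h : inc i), P i h.
Proof.
move=> Pt Ps [a|b] [h hP].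
  have E := eqP hP; subst a; rewrite (_ : exist _ h hP = at_tgt h) //.
  exact: val_inj.
have E := eqP hP; subst b; rewrite (_ : exist _ h hP = at_src h) //.
exact: val_inj.
Qed.

Section Rep.
Variable w : wvec Q.
Local Notation rep := {ffun Ecoord w -> K}.

Definition wstar (i : vert Q) : finType :=
  star (wdim' w i) (fun h : inc i => wdim w (opp h)).

Definition xv (e : rep) (i : vert Q) : 'M[K]_(wdim w i, wdim' w i) :=
  \matrix_(r, c) e (inl (Tagged
    (fun i => ('I_(wdim' w i) * 'I_(wdim w i))%type) (c, r))).

Definition yv (e : rep) (i : vert Q) :
    forall h : inc i, 'M[K]_(wdim w i, wdim w (opp h)) :=
  match i with
  | inl a => fun h => (colsub (cast_ord (wdim_tgt w h)) (yarrow e (val h)))^T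
  | inr b => fun h => rowsub (cast_ord (wdim_src w h)) (yarrow e (val h))
  end.

(** At a sink this is the transpose of the matrix of [A_i]: the rows are always
indexed by [W_i], so that sinks and sources obey the same formulas. *)
Definition Bmx (e : rep) (i : vert Q) : 'M[K]_(wdim w i, #|wstar i|) :=
  srow (xv e i) (yv e (i := i)).

Lemma yv_tgt e h : yv e (at_tgt h) = (yarrow e h)^T.
Proof. by apply/matrixP => r c; rewrite !mxE cast_ord_id. Qed.

Lemma yv_src e h : yv e (at_src h) = yarrow e h.
Proof. by apply/matrixP => r c; rewrite !mxE cast_ord_id. Qed.

Lemma Bmx_sink e a : Amap e (inl a) = (Bmx e (inl a))^T.
Proof.
apply/matrixP => r c; rewrite !mxE.
case: (enum_val r) => [r'|[h r']]; by rewrite !mxE.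
Qed.

Lemma Bmx_source e b : Amap e (inr b) = Bmx e (inr b).
Proof.
apply/matrixP => r c; rewrite !mxE.
case: (enum_val c) => [c'|[h c']]; by rewrite !mxE.
Qed.

Lemma scol_Bmx e i (h : inc i) : scol h (Bmx e i) = yv e h.
Proof. exact: srowK. Qed.

Lemma scol0_Bmx e i : scol0 (Bmx e i) = xv e i.
Proof. exact: srowK0. Qed.

Lemma rank_Bmx e i : \rank (Bmx e i) = \rank (Amap e i).
Proof. by case: i => [a|b]; rewrite ?Bmx_sink ?mxrank_tr ?Bmx_source. Qed.

Lemma yv_sub e b (h : inc (inr b)) : (yv e h <= Amap e (opp h))%MS.
Proof.
pose P (i : vert Q) : inc i -> Prop := match i with
  | inl _ => fun _ => True
  | inr _ => fun h => (yv e h <= Amap e (opp h))%MS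
  end.
apply: (@inc_ind P _ _ (inr b) h) => // {}h; rewrite /P yv_src Bmx_sink.
rewrite -[yarrow e h]trmxK -yv_tgt -scol_Bmx.
by rewrite trmx_mxsub rowsub_sub.
Qed.

Lemma rep_eq (e e' : rep) : (forall i, xv e i = xv e' i) ->
  (forall h, yarrow e h = yarrow e' h) -> e = e'.
Proof.
move=> ex ey; apply/ffunP => -[[i [c r]]|[h [r c]]].
  by have /matrixP/(_ r c) := ex i; rewrite !mxE.
by have /matrixP/(_ r c) := ey h; rewrite !mxE.
Qed.

Lemma xvD (e e' : rep) i : xv (e + e') i = xv e i + xv e' i.
Proof. by apply/matrixP => r c; rewrite !mxE ffunE. Qed.

Lemma yarrowD (e e' : rep) h : yarrow (e + e') h = yarrow e h + yarrow e' h.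
Proof. by apply/matrixP => r c; rewrite !mxE ffunE. Qed.

Lemma BmxD (e e' : rep) i : Bmx (e + e') i = Bmx e i + Bmx e' i.
Proof.
apply/matrixP => r c; rewrite !mxE.
case: (enum_val c) => [c'|[h c']]; first by rewrite !mxE ffunE.
by case: i h r c c' => [a|b] h r c c'; rewrite !mxE ffunE.
Qed.

Lemma BmxZ (x : K) (e : rep) i : Bmx [ffun j => x * e j] i = x *: Bmx e i.
Proof.
apply/matrixP => r c; rewrite !mxE.
case: (enum_val c) => [c'|[h c']]; first by rewrite !mxE ffunE.
by case: i h r c c' => [a|b] h r c c'; rewrite !mxE ffunE.
Qed.

Definition mkrep (X : forall i, 'M[K]_(wdim w i, wdim' w i))
    (Y : forall h, 'M[K]_(wdim w (inr (src h)), wdim w (inl (tgt h)))) : rep :=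
  [ffun j => match j with
     | inl (existT i (c, r)) => X i r c
     | inr (existT h (r, c)) => Y h r c
     end].

Lemma xv_mkrep X Y i : xv (mkrep X Y) i = X i.
Proof. by apply/matrixP => r c; rewrite !mxE ffunE. Qed.

Lemma yarrow_mkrep X Y h : yarrow (mkrep X Y) h = Y h.
Proof. by apply/matrixP => r c; rewrite !mxE ffunE. Qed.

Lemma Bmx_eq0 (e : rep) : (forall i, Bmx e i = 0) -> e = 0.
Proof.
move=> e0; apply: rep_eq => [i|h].
  rewrite -scol0_Bmx e0 scol0_0.
  by apply/matrixP => r c; rewrite !mxE ffunE.
rewrite -yv_src -scol_Bmx e0 scol_0.
by apply/matrixP => r c; rewrite !mxE ffunE.
Qed.

End Rep.

(** * The slice *)

Section Slice.
Variables (w wp : wvec Q) (v0 : vert Q -> nat).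
Local Notation rep := {ffun Ecoord w -> K}.
Local Notation rep' := {ffun Ecoord wp -> K}.

(** The star of [i] in which only the first summands of the neighbours are
kept: it indexes the part of the big space at [i] in which the pivot lives. *)
Definition pstar (i : vert Q) : finType :=
  star (wdim' w i) (fun h : inc i => v0 (opp h)).

Variable D : forall i, splitting K (wdim w i) (v0 i) (wdim wp i).
Variable E : forall i, splitting K #|pstar i| (v0 i) (wdim' wp i).

Definition star_spI (i : vert Q) : 'M[K]_(#|wstar w i|, #|pstar i|) :=
  sdiag _ (fun h : inc i => spI (D (opp h))).

(* [star_pivot] and [lam] are locked so that the associativity of the matrix
product does not see through them. *)
Fact star_pivot_key : unit. Proof. exact: tt. Qed.
Definition star_pivot i := locked_with star_pivot_key (star_spI i *m spI (E i)).

Lemma star_pivotE i : star_pivot i = star_spI i *m spI (E i).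
Proof. exact: locked_withE. Qed.

Definition pivot (e : rep) i := (spI (D i))^T *m Bmx e i *m star_pivot i.

Definition generic (e : rep) := forall i, pivot e i \in unitmx.

Fact lam_key : unit. Proof. exact: tt. Qed.
(** After the change of basis these are the coordinates along the first summand
of [W_i] at a source, and the transpose is a basis of the first summand at a
sink. They depend on [e] only through the product with [star_pivot i], that is,
through the pivot columns. *)
Definition lam (e : rep) i :=
  locked_with lam_key (Bmx e i *m star_pivot i *m invmx (pivot e i)).

Lemma lamE e i : lam e i = Bmx e i *m star_pivot i *m invmx (pivot e i).
Proof. exact: locked_withE. Qed.

(** The rows of [rho e i] span the second summand of [W_i] at a source, and its
transpose is the projection to the second summand at a sink, after the
unipotent change of basis that clears the row or the column of the pivot. *)
Definition rho (e : rep) i :=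
  (spC (D i))^T - (spC (D i))^T *m lam e i *m (spI (D i))^T.

(** The complement of the pivot directions in the star of [i], adapted to the
new bases of the neighbours. *)
Definition slice_star (e : rep) i : 'M[K]_(#|wstar w i|, #|wstar wp i|) :=
  star_rest (fun h : inc i => spI (D (opp h)))
    (fun h => (rho e (opp h))^T) (spC (E i)).

Definition slice (e : rep) : rep' :=
  mkrep (fun i => rho e i *m Bmx e i *m star_spI i *m spC (E i))
    (fun h => rho e (inr (src h)) *m yarrow e h *m (rho e (inl (tgt h)))^T).

Lemma spI_lam e i : generic e -> (spI (D i))^T *m lam e i = 1%:M.
Proof.
by move=> ge; rewrite lamE mulmxA [_ *m (_ *m star_pivot i)]mulmxA mulmxV.
Qed.

Lemma rho_lam e i : generic e -> rho e i *m lam e i = 0.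
Proof.
move=> ge; rewrite /rho mulmxBl -[_ *m _ *m lam e i]mulmxA spI_lam //.
by rewrite mulmx1 subrr.
Qed.

Lemma rho_spJ e i : rho e i *m (spJ (D i))^T = 1%:M.
Proof.
by rewrite /rho mulmxBl -!mulmxA -!trmx_mul spJI spJC trmx0 !mulmx0 subr0 trmx1.
Qed.

Lemma rho_inj e i p (u : 'M[K]_(p, wdim w i)) :
  u *m spI (D i) = 0 -> u *m (rho e i)^T = 0 -> u = 0.
Proof.
move=> uI; rewrite /rho linearB /= !trmx_mul !trmxK mulmxBr !mulmxA uI !mul0mx.
by rewrite subr0; apply: sp_inj.
Qed.

Lemma yv_slice e i (h : inc i) :
  yv (slice e) h = rho e i *m yv e h *m (rho e (opp h))^T.
Proof.
move: i h; apply: inc_ind => h.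
  by rewrite !yv_tgt yarrow_mkrep /= !trmx_mul trmxK mulmxA.
by rewrite !yv_src yarrow_mkrep.
Qed.

Lemma Bmx_slice e i : Bmx (slice e) i = rho e i *m Bmx e i *m slice_star e i.
Proof.
apply: scol_eq => [|h]; first by rewrite srowK0 xv_mkrep star_rest0.
by rewrite srowK yv_slice star_restE scolM srowK.
Qed.

(** The projection between the targets of [A_i]: at a sink only [W_i] is
changed, at a source also the neighbours, through [slice_star]. *)
Definition qmx (e : rep) (i : vert Q) : 'M[K]_(Acod w i, Acod wp i) :=
  match i with
  | inl a => (rho e (inl a))^T
  | inr b => schur_proj (Bmx e (inr b)) (spI (D (inr b)))^T (star_pivot (inr b))
               (slice_star e (inr b))
  end.

Lemma card_wstar i : #|wstar w i| = (v0 i + #|wstar wp i|)%N.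
Proof.
rewrite card_star (eq_bigr (fun h : inc i => v0 (opp h) + wdim wp (opp h))%N);
  last by move=> h _; apply: sp_dim (D _).
rewrite big_split addnA -(card_star (wdim' w i) (fun h : inc i => v0 (opp h))).
by rewrite (sp_dim (E i)) -addnA -card_star.
Qed.

Lemma slice_star_inj e i p (u : 'M[K]_(p, #|wstar w i|)) :
  u *m slice_star e i = 0 -> u *m star_pivot i = 0 -> u = 0.
Proof.
rewrite star_pivotE; apply: star_rest_inj => [h q x|q x].
  exact: rho_inj.
exact: sp_inj.
Qed.

(** At a source, [rho e i] clears the pivot from the left and the Schur
complement is taken with respect to the adapted complement of the star; at a
sink the roles of rows and columns are exchanged. That both ends of an arrow
produce the same block is built into [slice]. *)
Lemma slice_reduction e i : generic e ->
  schur_reduction (v0 i) (Amap e i) (qmx e i) (Amap (slice e) i).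
Proof.
move=> ge; have gi := ge i; case: i gi => [a|b] gi.
  have qE : (rho e (inl a))^T = schur_proj (Bmx e (inl a))^T
      (star_pivot (inl a))^T (spI (D (inl a))) (spC (D (inl a))).
    rewrite /schur_proj /rho lamE linearB /= !trmx_mul !trmxK trmx_inv.
    by rewrite /pivot !trmx_mul !trmxK !mulmxA.
  rewrite /= -/(Amap e (inl a)) -/(Amap (slice e) (inl a)) !Bmx_sink.
  rewrite Bmx_slice !trmx_mul mulmxA qE; apply: schur_projP.
  - by rewrite -unitmx_tr !trmx_mul !trmxK mulmxA.
  - move=> x Rx mx; apply: trmx_inj; rewrite trmx0.
    by apply: (@slice_star_inj e (inl a)); apply: trmx_inj;
      rewrite trmx_mul trmxK trmx0.
  - by move=> u uC uI; apply: sp_inj uI uC.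
  - exact: sp_dim (D (inl a)).
rewrite -/(Amap e (inr b)) !Bmx_source.
rewrite (_ : Bmx (slice e) _ =
             (spC (D (inr b)))^T *m Bmx e (inr b) *m qmx e (inr b)).
  apply: schur_projP => //.
  - move=> x Cx Ix; apply: trmx_inj; rewrite trmx0.
    apply: (sp_inj (s := D (inr b)));
      by apply: trmx_inj; rewrite trmx_mul trmxK trmx0.
  - by move=> u; apply: slice_star_inj.
  - exact: card_wstar.
rewrite Bmx_slice /qmx schur_projE; congr (_ *m _).
by rewrite /rho lamE mulmxBl !mulmxA.
Qed.

Lemma rank_slice e i : generic e ->
  \rank (Amap e i) = (v0 i + \rank (Amap (slice e) i))%N.
Proof. by move=> ge; case: (slice_reduction i ge). Qed.

(** * Recovering a representation from its slice coordinates *)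

(** The block [x_i] of [t], between the second summand of [W_i] and the
complement of the pivot in [pstar i]. It has components on the branches of the
star too, so it contributes to the arrows at [i]. *)
Definition lift_block (t : rep') i : 'M[K]_(wdim w i, #|pstar i|) :=
  (spJ (D i))^T *m xv t i *m spJ (E i).

(** The element of [E_w] which has the blocks [t] with respect to the
decompositions adapted to a point with [lam e = L], and vanishing other blocks.
*)
Definition lift (L : forall i, 'M[K]_(wdim w i, v0 i)) (t : rep') : rep :=
  mkrep (fun i => scol0 (lift_block t i))
    (fun h => (spJ (D (inr (src h))))^T *m yarrow t h *m spJ (D (inl (tgt h)))
       + L (inr (src h)) *m (scol (at_tgt h) (lift_block t (inl (tgt h))))^T
       + scol (at_src h) (lift_block t (inr (src h))) *m (L (inl (tgt h)))^T).

Lemma spI_lift_block t i : (spI (D i))^T *m lift_block t i = 0.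
Proof. by rewrite /lift_block !mulmxA -trmx_mul spJI trmx0 !mul0mx. Qed.

Lemma rho_lift_block e t i : rho e i *m lift_block t i = xv t i *m spJ (E i).
Proof. by rewrite /lift_block !mulmxA rho_spJ mul1mx. Qed.

Section Lift.
Variables (e : rep) (t : rep').
Hypothesis ge : generic e.
Local Notation dl := (lift (lam e) t).

(** Towards the first summand of a neighbour only the block at [i] itself
contributes: the blocks of the arrow and of the neighbour only involve the
second summand of the neighbour. *)
Lemma lift_spI i (h : inc i) :
  yv dl h *m spI (D (opp h)) = scol h (lift_block t i).
Proof.
move: i h; apply: inc_ind => h.
  rewrite yv_tgt yarrow_mkrep; apply: trmx_inj; rewrite trmx_mul trmxK /=.
  rewrite !mulmxDr !mulmxA -trmx_mul spJI trmx0 !mul0mx add0r.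
  by rewrite spI_lam // mul1mx -scolM spI_lift_block scol_0 mul0mx addr0.
rewrite yv_src yarrow_mkrep /= !mulmxDl -!mulmxA spJI !mulmx0 add0r.
have IL : (lam e (inl (tgt h)))^T *m spI (D (inl (tgt h))) = 1%:M.
  by apply: trmx_inj; rewrite trmx_mul trmxK spI_lam // trmx1.
rewrite IL mulmx1; have -> :
    (scol (at_tgt h) (lift_block t (inl (tgt h))))^T *m
    spI (D (inl (tgt h))) = 0.
  by apply: trmx_inj; rewrite trmx_mul trmxK -scolM spI_lift_block scol_0 trmx0.
by rewrite mulmx0 add0r.
Qed.

Lemma Bmx_lift i : Bmx dl i *m star_spI i = lift_block t i.
Proof.
apply: scol_eq => [|h]; first by rewrite sdiag0 srowK0 xv_mkrep.
by rewrite sdiagE srowK lift_spI.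
Qed.

(** The added blocks avoid the pivot columns. *)
Lemma star_pivot_lift i :
  Bmx (e + dl) i *m star_pivot i = Bmx e i *m star_pivot i.
Proof.
rewrite BmxD mulmxDl {2}star_pivotE [X in _ + X]mulmxA Bmx_lift /lift_block.
by rewrite -mulmxA spJI mulmx0 addr0.
Qed.

Lemma pivot_lift i : pivot (e + dl) i = pivot e i.
Proof. by rewrite /pivot -!mulmxA star_pivot_lift. Qed.

Lemma generic_lift : generic (e + dl).
Proof. by move=> i; rewrite pivot_lift. Qed.

Lemma lam_lift : lam (e + dl) = lam e.
Proof.
apply: functional_extensionality_dep => i.
by rewrite !lamE star_pivot_lift pivot_lift.
Qed.

Lemma rho_lift i : rho (e + dl) i = rho e i.
Proof. by rewrite /rho lam_lift. Qed.

(** Since [rho], [lam] are unchanged and dual to the bases used in [lift],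
reading off the blocks of [e + dl] adds [t] to those of [e]. *)
Lemma slice_lift : slice (e + dl) = slice e + t.
Proof.
apply: rep_eq => [i|h].
  rewrite [RHS]xvD [LHS]xv_mkrep [in RHS]xv_mkrep rho_lift BmxD.
  rewrite mulmxDr 2!mulmxDl.
  congr (_ + _); rewrite -[rho e i *m _ *m _]mulmxA Bmx_lift rho_lift_block.
  by rewrite -mulmxA spJC mulmx1.
rewrite [RHS]yarrowD [LHS]yarrow_mkrep [in RHS]yarrow_mkrep !rho_lift.
rewrite yarrowD [yarrow dl h]yarrow_mkrep.
rewrite mulmxDr mulmxDl; congr (_ + _).
have key m m' n n' r r' (P : 'M[K]_(m', m)) (J : 'M[K]_(m', m)) (L : 'M_(m, r))
    (P' : 'M[K]_(n', n)) (J' : 'M[K]_(n', n)) (L' : 'M_(n, r')) y Z Z' :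
    P *m J^T = 1%:M -> P *m L = 0 -> P' *m J'^T = 1%:M -> P' *m L' = 0 ->
    P *m (J^T *m y *m J' + L *m Z + Z' *m L'^T) *m P'^T = y.
  move=> PJ PL PJ' PL'; have JP' : J' *m P'^T = 1%:M.
    by apply: trmx_inj; rewrite trmx_mul trmxK trmx1.
  have LP' : L'^T *m P'^T = 0 by rewrite -trmx_mul PL' trmx0.
  rewrite !mulmxDr !mulmxDl !mulmxA PJ PL mul1mx !mul0mx addr0.
  by rewrite -!mulmxA JP' LP' !mulmx0 mulmx1 addr0.
by apply: key; rewrite ?rho_spJ ?rho_lam.
Qed.

End Lift.

Lemma lift0 L : lift L 0 = 0.
Proof.
have x0 i : xv (0 : rep') i = 0 by apply/matrixP => r c; rewrite !mxE ffunE.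
have Z0 i : lift_block 0 i = 0 by rewrite /lift_block x0 mulmx0 mul0mx.
have y0 (w' : wvec Q) h : yarrow (0 : {ffun Ecoord w' -> K}) h = 0.
  by apply/matrixP => r c; rewrite !mxE ffunE.
apply: rep_eq => [i|h].
  by rewrite xv_mkrep Z0 scol0_0; apply/matrixP => r c; rewrite !mxE ffunE.
rewrite yarrow_mkrep !y0 !Z0 !scol_0 trmx0.
by rewrite !mulmx0 !mul0mx !addr0.
Qed.

Lemma liftD L t t' : lift L (t + t') = lift L t + lift L t'.
Proof.
have ZD i : lift_block (t + t') i = lift_block t i + lift_block t' i.
  by rewrite /lift_block xvD mulmxDr mulmxDl.
apply: rep_eq => [i|h].
  rewrite [RHS]xvD !xv_mkrep ZD; apply/matrixP => r c; by rewrite !mxE.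
rewrite [RHS]yarrowD !yarrow_mkrep yarrowD !ZD.
have trD m n (A B : 'M[K]_(m, n)) : (A + B)^T = A^T + B^T by apply: linearD.
by rewrite !scolD trD !mulmxDr !mulmxDl [X in X + _ = _]addrACA [LHS]addrACA.
Qed.

(** * Flags *)

Definition arrow_stable (w' : wvec Q)
    (X : forall i, {vspace 'rV[K]_(Acod w' i)}) : Prop :=
  forall (b : source Q) (u : 'rV[K]_#|source_idx w' b|), u \in X (inr b) ->
    forall h : {h : arrow Q | src h == b},
      arrow_comp h u \in X (inl (tgt (val h))).

Lemma arrow_compE (w' : wvec Q) b (h : inc (inr b))
  (u : 'rV[K]_#|wstar w' (inr b)|) : arrow_comp h u = scol h u.
Proof. by apply/rowP => c; rewrite !mxE. Qed.

Local Notation f e i :=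
  (linfun (mulmxr (qmx e i) : 'rV[K]_(Acod w i) -> 'rV[K]_(Acod wp i))).

(** The projection at the source [b] first subtracts from [u] an element of the
image of [A_b] to clear the pivot; the component of this element along [h] is
in the image of the map at the sink, as it is the image of a vector under the
arrow [h]. *)
Lemma arrow_comp_qmx e b (h : inc (inr b)) (u : 'rV[K]_#|wstar w (inr b)|) :
  exists2 x, x \in mximage (Amap e (opp h)) &
    arrow_comp h (u *m qmx e (inr b)) =
      (arrow_comp h u - x) *m qmx e (opp h).
Proof.
set c := u *m star_pivot (inr b) *m invmx (pivot e (inr b)) *m
  (spI (D (inr b)))^T.
exists (c *m yv e h).
  by rewrite mem_mximage (submx_trans (submxMl _ _)) ?yv_sub.
rewrite !arrow_compE /qmx schur_projE star_restE; congr (_ *m _).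
by rewrite !mulmxA -/c scolD scolN scolM scol_Bmx.
Qed.

(** The correction term of [arrow_comp_qmx] lies in the subspace at the sink
because that subspace contains the image of the map there. *)
Lemma arrow_stable_push e (X : forall i, {vspace 'rV[K]_(Acod w i)}) :
  generic e -> (forall i, (mximage (Amap e i) <= X i)%VS) ->
  arrow_stable X <-> arrow_stable (fun i => (f e i @: X i)%VS).
Proof.
move=> ge AX; split=> sX b u.
  move=> /memv_imgP[x xX ->] h; rewrite lfunE /=.
  have [y yA ->] := arrow_comp_qmx e (b := b) h x.
  have -> : (arrow_comp h x - y) *m qmx e (opp (i := inr b) h) =
     f e (inl (tgt (val h))) (arrow_comp h x - y) by rewrite lfunE.
  apply: memv_img; apply: memvB; first exact: sX.
  exact: (subvP (AX (inl (tgt (val h))))).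
move=> uX h.
have := sX b (u *m qmx e (inr b)).
have -> : u *m qmx e (inr b) = f e (inr b) u by rewrite lfunE.
move=> /(_ (memv_img _ uX) h).
rewrite lfunE /=; have [y yA ->] := arrow_comp_qmx e (b := b) h u.
have -> : (arrow_comp h u - y) *m qmx e (opp (i := inr b) h) =
   f e (inl (tgt (val h))) (arrow_comp h u - y) by rewrite lfunE.
have [_ _ push _] := slice_reduction (inl (tgt (val h))) ge.
have [_ _ fK] := push _ (AX _); rewrite memv_preim fK => uyX.
rewrite -[arrow_comp h u](subrK y) memvD //.
exact: (subvP (AX (inl (tgt (val h))))).

Qed.

End Slice.
End Vertex.

(** * Decompositions adapted to a point *)

Section SliceData.
Variables (K : fieldType) (Q : bquiver) (w : wvec Q) (v0 : vert Q -> nat).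

Lemma sum_inc (i : vert Q) (F : vert Q -> nat) :
  (\sum_(h : inc i) F (opp h))%:Z = nbrsum (fun j => (F j)%:Z) i.
Proof.
case: i => [a|b] /=; rewrite (big_morph _ (@PoszD) (erefl _)).
  by rewrite -(big_sub [pred h | tgt h == a] (fun h => (F (inr (src h)))%:Z)).
by rewrite -(big_sub [pred h | src h == b] (fun h => (F (inl (tgt h)))%:Z)).
Qed.

(** The splitting of [W_i] is adapted to the map at [p]; the second splitting
is chosen afterwards, once the maps are restricted to the first summands of the
neighbours. *)
Lemma slice_data (p : Ew K w) : Evo v0 p ->
  exists (wp : wvec Q) (D : forall i, splitting K (wdim w i) (v0 i) (wdim wp i))
    (E : forall i, splitting K #|pstar w v0 i| (v0 i) (wdim' wp i)),
    [/\ is_wperp w v0 wp, generic D E p &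
        forall i, (spC (D i))^T *m Bmx p i = 0].
Proof.
move=> rp; have rB i : \rank (Bmx p i) = v0 i by rewrite rank_Bmx.
pose wp := WVec (fun i => wdim w i - v0 i)%N
  (fun i => #|pstar w v0 i| - v0 i)%N.
have le1 i : (v0 i <= wdim w i)%N by rewrite -rB rank_leq_row.
have exD i : exists s : splitting K (wdim w i) (v0 i) (wdim wp i),
    (Bmx p i)^T *m spC s = 0 /\ \rank ((Bmx p i)^T *m spI s) = v0 i.
  by apply: splitting_exists; rewrite ?mxrank_tr ?subnKC.
pose D i := projT1 (cid (exD i)).
have BC i : (spC (D i))^T *m Bmx p i = 0.
  apply: trmx_inj; rewrite trmx_mul trmxK trmx0.
  by case: (projT2 (cid (exD i))).
have rI i : \rank ((spI (D i))^T *m Bmx p i) = v0 i.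
  by rewrite -mxrank_tr trmx_mul trmxK; case: (projT2 (cid (exD i))).
have yC i (h : inc i) : yv p h *m spC (D (opp h)) = 0.
  have Cy h' : (spC (D (inr (src h'))))^T *m yarrow p h' = 0.
    have : scol (at_src h')
        ((spC (D (inr (src h'))))^T *m Bmx p (inr (src h'))) = 0.
      by rewrite BC scol_0.
    by rewrite scolM scol_Bmx yv_src.
  have yCt h' : yarrow p h' *m spC (D (inl (tgt h'))) = 0.
    have : scol (at_tgt h')
        ((spC (D (inl (tgt h'))))^T *m Bmx p (inl (tgt h'))) = 0.
      by rewrite BC scol_0.
    rewrite scolM scol_Bmx yv_tgt => yC; apply: trmx_inj.
    by rewrite trmx_mul trmx0.
  move: i h; apply: inc_ind => h; last by rewrite yv_src yCt.
  by apply: trmx_inj; rewrite trmx_mul trmx0 yv_tgt trmxK Cy.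
(* The map at [p] does not see the second summand of a neighbour, so its rank
does not drop under restriction to the first ones. *)
have BI0 i m (x : 'M[K]_(m, _)) :
    x *m Bmx p i *m sdiag _ (fun h : inc i => spI (D (opp h))) = 0 ->
    x *m Bmx p i = 0.
  move=> x0; apply: scol_eq => [|h].
    by rewrite -(sdiag0 (fun h : inc i => spI (D (opp h)))) x0 !scol0_0.
  rewrite scol_0; apply: (sp_inj (s := D (opp h))).
    by rewrite -(sdiagE (fun h : inc i => spI (D (opp h)))) x0 scol_0.
  by rewrite scolM scol_Bmx -mulmxA yC mulmx0.
pose G i := (spI (D i))^T *m Bmx p i *m
  sdiag (wdim' w i) (fun h : inc i => spI (D (opp h))).
have rG i : \rank (G i) = v0 i.
  apply/eqP; rewrite -/(row_free _) -kermx_eq0; apply/rowV0P => u.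
  move=> /sub_kermxP; rewrite /G !mulmxA => /BI0.
  rewrite -mulmxA => u0; have : row_free ((spI (D i))^T *m Bmx p i).
    by rewrite /row_free rI.
  rewrite -kermx_eq0 => /rowV0P; apply; exact/sub_kermxP.
have le2 i : (v0 i <= #|pstar w v0 i|)%N by rewrite -(rG i) rank_leq_col.
have exE i : exists s : splitting K #|pstar w v0 i| (v0 i) (wdim' wp i),
    G i *m spC s = 0 /\ \rank (G i *m spI s) = v0 i.
  by apply: splitting_exists; rewrite ?subnKC.
pose E i := projT1 (cid (exE i)).
have rE i : \rank (G i *m spI (E i)) = v0 i by case: (projT2 (cid (exE i))).
exists wp, D, E; split=> // i.
- split; rewrite /= -subzn //.
  by rewrite card_star PoszD sum_inc opprB addrA.
- rewrite /pivot star_pivotE mulmxA -/(G i) -row_full_unit /row_full.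
  by rewrite rE.
Qed.

End SliceData.

(** * The slice maps are regular *)

Section Regularity.
Variables (K : fieldType) (Z : Defs.space K).
Hypothesis kZ : kempf Z.
Let oT : zopen (setT : set Z) := kempf_openT kZ.

Local Notation reg F := (regular_mx (X := Z) setT F).

Lemma regular_mx_ext m n (F G : Z -> 'M[K]_(m, n)) :
  F =1 G -> reg G -> reg F.
Proof. by move=> FG; apply: regular_mx_eq => // z _; apply: FG. Qed.

Lemma regular_trmx m n (F : Z -> 'M[K]_(m, n)) :
  reg F -> reg (fun z => (F z)^T).
Proof.
move=> rF i j; apply: (regular_eq kZ oT oT _ _ (rF j i)) => // z _.
by rewrite mxE.
Qed.

Lemma regular_mxsub m n m' n' (f : 'I_m' -> 'I_m) (g : 'I_n' -> 'I_n)
    (F : Z -> 'M[K]_(m, n)) : reg F -> reg (fun z => mxsub f g (F z)).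
Proof.
move=> rF i j; apply: (regular_eq kZ oT oT _ _ (rF (f i) (g j))) => // z _.
by rewrite mxE.
Qed.

Lemma regular_srow (H : finType) (n0 : nat) (n : H -> nat) p
    (F0 : Z -> 'M[K]_(p, n0)) (F : forall h, Z -> 'M[K]_(p, n h)) :
  reg F0 -> (forall h, reg (F h)) ->
  reg (fun z => srow (F0 z) (fun h => F h z)).
Proof.
move=> rF0 rF i j; case jE: (enum_val j) => [c|[h c]].
  apply: (regular_eq kZ oT oT _ _ (rF0 i c)) => // z _.
  by rewrite mxE jE.
apply: (regular_eq kZ oT oT _ _ (rF h i c)) => // z _.
by rewrite mxE jE.
Qed.

Section OneRep.
Variables (Q : bquiver) (w : wvec Q).

Lemma morphism_rep (e : Z -> Ew K w) :
  (forall i, reg (fun z => xv (e z) i)) ->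
  (forall h, reg (fun z => yarrow (e z) h)) -> is_morphism e.
Proof.
move=> rx ry; apply: morphism_affsp => // -[[i [c r]]|[h [r c]]].
  by apply: (regular_eq kZ oT oT _ _ (rx i r c)) => // z _; rewrite mxE.
by apply: (regular_eq kZ oT oT _ _ (ry h r c)) => // z _; rewrite mxE.
Qed.

Variable e : Z -> Ew K w.
Hypothesis me : is_morphism e.

Lemma regular_xv i : reg (fun z => xv (e z) i).
Proof.
move=> r c; have := regular_coord (inl (Tagged
  (fun i => ('I_(wdim' w i) * 'I_(wdim w i))%type) (c, r))) me.
by apply: regular_eq => // z _; rewrite mxE.
Qed.

Lemma regular_yarrow h : reg (fun z => yarrow (e z) h).
Proof.
move=> r c; have := regular_coord (inr (Tagged (fun h =>
  ('I_(wdim w (inr (src h))) * 'I_(wdim w (inl (tgt h))))%type) (r, c))) me.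
by apply: regular_eq => // z _; rewrite mxE.
Qed.

Lemma regular_Bmx i : reg (fun z => Bmx (e z) i).
Proof.
apply: regular_srow => [|h]; first exact: regular_xv.
case: i h => [a|b] h; last by apply: regular_mxsub; apply: regular_yarrow.
by apply: regular_trmx; apply: regular_mxsub; apply: regular_yarrow.
Qed.

Lemma regular_Amap i : reg (fun z => Amap (e z) i).
Proof.
case: i => [a|b].
  apply: (regular_mx_ext (G := fun z => (Bmx (e z) (inl a))^T)).
    by move=> z; rewrite Bmx_sink.
  by apply: regular_trmx; apply: regular_Bmx.
apply: (regular_mx_ext (G := fun z => Bmx (e z) (inr b))).
  by move=> z; rewrite Bmx_source.
exact: regular_Bmx.
Qed.

Lemma morphism_repD (e' : Z -> Ew K w) : is_morphism e' ->
  is_morphism (X := Z) (Y := Ew K w) (fun z => e z + e' z).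
Proof.
move=> me'; apply: morphism_affsp => // j.
apply: (regular_eq kZ oT oT _ _
  (kempfD kZ oT (regular_coord j me) (regular_coord j me'))) => // z _.
by rewrite ffunE.
Qed.

Lemma morphism_repN : is_morphism (X := Z) (Y := Ew K w) (fun z => - e z).
Proof.
move=> *; apply: morphism_affsp => // j.
apply: (regular_eq kZ oT oT _ _
  (kempfM kZ oT (kempf_cst kZ (-1) oT) (regular_coord j me))) => // z _.
by rewrite ffunE mulN1r.
Qed.

End OneRep.

Section RegularSlice.
Variables (Q : bquiver) (w wp : wvec Q) (v0 : vert Q -> nat).
Variable D : forall i, splitting K (wdim w i) (v0 i) (wdim wp i).
Variable E : forall i, splitting K #|pstar w v0 i| (v0 i) (wdim' wp i).
Variable e : Z -> Ew K w.
Hypothesis me : is_morphism e.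

Local Notation cst := (regular_mx_cst kZ oT).

Lemma regular_pivot i : reg (fun z => pivot D E (e z) i).
Proof.
apply: regular_mxM => //; last exact: cst.
by apply: regular_mxM => //; [apply: cst | apply: regular_Bmx].
Qed.

Hypothesis ge : forall z, generic D E (e z).

Lemma regular_lam i : reg (fun z => lam D E (e z) i).
Proof.
apply: (regular_mx_ext (G := fun z => Bmx (e z) i *m star_pivot D E i *m
  invmx (pivot D E (e z) i))); first by move=> z; rewrite lamE.
apply: regular_mxM => //; last first.
  apply: regular_invmx => //; first exact: regular_pivot.
  by move=> z _; apply: ge.
by apply: regular_mxM => //; [apply: regular_Bmx | apply: cst].
Qed.

Lemma regular_rho i : reg (fun z => rho D E (e z) i).
Proof.
apply: regular_mxB => //; first exact: cst.
apply: regular_mxM => //; last exact: cst.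
by apply: regular_mxM => //; [apply: cst | apply: regular_lam].
Qed.

Lemma morphism_slice :
  is_morphism (X := Z) (Y := Ew K wp) (fun z => slice D E (e z)).
Proof.
apply: morphism_rep => [i|h].
  apply: (regular_mx_ext (G := fun z =>
    rho D E (e z) i *m Bmx (e z) i *m star_spI D i *m spC (E i))).
    by move=> z; rewrite xv_mkrep.
  do 2![apply: regular_mxM => //; last exact: cst].
  by apply: regular_mxM => //; [apply: regular_rho | apply: regular_Bmx].
apply: (regular_mx_ext (G := fun z => rho D E (e z) (inr (src h)) *m
    yarrow (e z) h *m (rho D E (e z) (inl (tgt h)))^T)).
  by move=> z; rewrite yarrow_mkrep.
apply: regular_mxM => //; last by apply: regular_trmx; apply: regular_rho.
by apply: regular_mxM => //; [apply: regular_rho | apply: regular_yarrow].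
Qed.

Lemma regular_slice_star i : reg (fun z => slice_star D E (e z) i).
Proof.
apply: regular_srow => [|h]; first exact: cst.
apply: regular_mxM => //; first exact: cst.
by apply: regular_trmx; apply: regular_rho.
Qed.

Lemma regular_qmx i : reg (fun z => qmx D E (e z) i).
Proof.
case: i => [a|b]; first by apply: regular_trmx; apply: regular_rho.
apply: regular_mxB => //; first exact: regular_slice_star.
apply: regular_mxM => //; last exact: regular_slice_star.
apply: regular_mxM => //; last first.
  by apply: regular_mxM => //; [apply: cst | apply: regular_Bmx].
apply: regular_mxM => //; first exact: cst.
apply: regular_invmx => //; first exact: regular_pivot.
by move=> z _; apply: ge.
Qed.

Lemma morphism_lift (t : Z -> Ew K wp) : is_morphism t ->
  is_morphism (X := Z) (Y := Ew K w) (fun z => lift D E (lam D E (e z)) (t z)).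
Proof.
move=> mt.
have rZ i : reg (fun z => lift_block D E (t z) i).
  apply: regular_mxM => //; last exact: cst.
  by apply: regular_mxM => //; [apply: cst | apply: regular_xv].
have rsc i (h : inc i) : reg (fun z => scol h (lift_block D E (t z) i)).
  exact: regular_mxsub.
apply: morphism_rep => [i|h].
  apply: (regular_mx_ext (G := fun z => scol0 (lift_block D E (t z) i))).
    by move=> z; rewrite xv_mkrep.
  exact: regular_mxsub.
apply: (regular_mx_ext (G := fun z =>
  (spJ (D (inr (src h))))^T *m yarrow (t z) h *m spJ (D (inl (tgt h)))
  + lam D E (e z) (inr (src h)) *m
      (scol (at_tgt h) (lift_block D E (t z) (inl (tgt h))))^T
  + scol (at_src h) (lift_block D E (t z) (inr (src h))) *m
      (lam D E (e z) (inl (tgt h)))^T)).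
  by move=> z; rewrite yarrow_mkrep.
apply: regular_mxD => //; last first.
  apply: (regular_mxM kZ oT (rsc _ (at_src h))).
  by apply: regular_trmx; apply: regular_lam.
apply: regular_mxD => //.
  apply: regular_mxM => //; last exact: cst.
  by apply: regular_mxM => //; [apply: cst | apply: regular_yarrow].
apply: regular_mxM => //; first exact: regular_lam.
by apply: regular_trmx; apply: (rsc _ (at_tgt h)).
Qed.

End RegularSlice.
End Regularity.

(** * The product decomposition *)

Section Chart.
Variables (K : fieldType) (Q : bquiver) (w wp : wvec Q) (v0 : vert Q -> nat).
Variable D : forall i, splitting K (wdim w i) (v0 i) (wdim wp i).
Variable E : forall i, splitting K #|pstar w v0 i| (v0 i) (wdim' wp i).
Local Notation rep := {ffun Ecoord w -> K}.
Local Notation rep' := {ffun Ecoord wp -> K}.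

Definition glue (e : rep) (t : rep') : rep := e + lift D E (lam D E e) t.

(** The component of [e] in the stratum of rank [v0]. *)
Definition base (e : rep) : rep := glue e (- slice D E e).

Section OneRep.
Variable e : rep.
Hypothesis ge : generic D E e.

Lemma generic_glue t : generic D E (glue e t).
Proof. exact: generic_lift. Qed.

Lemma slice_glue t : slice D E (glue e t) = slice D E e + t.
Proof. exact: slice_lift. Qed.

Lemma glue_glue t t' : glue (glue e t) t' = glue e (t + t').
Proof. by rewrite /glue lam_lift // -addrA -liftD. Qed.

Lemma glue0 : glue e 0 = e.
Proof. by rewrite /glue lift0 addr0. Qed.

Lemma slice_base : slice D E (base e) = 0.
Proof. by rewrite slice_glue subrr. Qed.

Lemma glue_base : glue (base e) (slice D E e) = e.
Proof. by rewrite glue_glue addNr glue0. Qed.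

Lemma base_glue t : slice D E e = 0 -> base (glue e t) = e.
Proof.
by move=> se; rewrite /base glue_glue slice_glue se add0r subrr glue0.
Qed.

Lemma Evo_slice0 : Evo v0 e <-> slice D E e = 0.
Proof.
split=> [re|s0 i].
  apply: Bmx_eq0 => i; apply/eqP; rewrite -mxrank_eq0 rank_Bmx.
  by rewrite -(eqn_add2l (v0 i)) -(rank_slice i ge) addn0 (re i).
rewrite (rank_slice i ge) s0 -rank_Bmx.
suff -> : Bmx (0 : rep') i = 0 by rewrite mxrank0 addn0.
have e0 : [ffun j => 0 * (0 : rep') j] = 0 :> rep'.
  by apply/ffunP => j; rewrite !ffunE mul0r.
by rewrite -e0 BmxZ scale0r.
Qed.

End OneRep.

Section Family.
Variables (Z : Defs.space K) (e : Z -> Ew K w).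
Hypotheses (kZ : kempf Z) (me : is_morphism e).
Hypothesis ge : forall z, generic D E (e z).
Let oT : zopen (setT : set Z) := kempf_openT kZ.

Lemma morphism_glue (t : Z -> Ew K wp) : is_morphism t ->
  is_morphism (X := Z) (Y := Ew K w) (fun z => glue (e z) (t z)).
Proof. by move=> mt; apply: morphism_repD => //; apply: morphism_lift. Qed.

Lemma morphism_base : is_morphism (X := Z) (Y := Ew K w) (fun z => base (e z)).
Proof.
apply: morphism_glue; apply: (morphism_repN kZ (e := fun z => slice D E (e z))).
exact: morphism_slice.
Qed.

Local Notation f e i := (linfun (mulmxr (qmx D E e i) :
  'rV[K]_(Acod w i) -> 'rV[K]_(Acod wp i))).

Variables (k k' : vert Q -> nat).
Variables (X : Z -> grassmannians K k (Acod w)).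
Variables (Y : Z -> grassmannians K k' (Acod wp)).

(** A local frame of [X z] is mapped to a spanning family of [Y z]. *)
Lemma morphism_push : is_morphism X ->
  (forall z i, gsub (Y z i) = (f (e z) i @: gsub (X z i))%VS) -> is_morphism Y.
Proof.
move=> mX YE; apply: morphism_grass => // z0.
have [V [S [oV Vz0 rS SX]]] := grass_local_frame (X z0).
have [oU rU] := mX V oV.
exists (X @^-1` V), k, (fun i z => S i (X z) *m qmx D E (e z) i); split=> //.
  move=> i; apply: regular_mxM => //.
    by move=> a b; apply: (rU _ (rS i a b)).
  by apply: (regular_mx_sub kZ oU oT) => //; apply: regular_qmx.
by move=> z Vz i; rewrite YE -SX // limg_mximage.
Qed.

Lemma morphism_pull : is_morphism Y ->
  (forall z i, (mximage (Amap (slice D E (e z)) i) <= gsub (Y z i))%VS) ->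
  (forall z i, gsub (X z i) = (f (e z) i @^-1: gsub (Y z i))%VS) ->
  is_morphism X.
Proof.
move=> mY AY XE; apply: morphism_grass => // z0.
have [V [S [oV Vz0 rS SY]]] := grass_local_frame (Y z0).
have [oU rU] := mY V oV.
have exT i : exists T : 'M[K]_(Acod wp i, Acod w i),
    T *m qmx D E (e z0) i = 1%:M.
  by apply/row_fullP; case: (slice_reduction i (ge z0)).
pose T i := projT1 (cid (exT i)).
have T1 i : T i *m qmx D E (e z0) i = 1%:M by apply: (projT2 (cid (exT i))).
have rq i : regular_mx setT (fun z => qmx D E (e z) i) by apply: regular_qmx.
have rT i : regular_mx setT (fun z => T i *m qmx D E (e z) i).
  by apply: regular_mxM => //; apply: regular_mx_cst.
have rTU i : regular_mx (Y @^-1` V) (fun z => T i *m qmx D E (e z) i).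
  exact: (regular_mx_sub kZ oU oT).
pose O := [set z | (Y @^-1` V) z /\
  forall i, T i *m qmx D E (e z) i \in unitmx].
have oO : zopen O by apply: open_unitmx.
have OU : O `<=` Y @^-1` V by move=> z [].
(* [invmx (T i *m q) *m T i] is a right inverse of the projection [q]; lifting a
frame along it and adding the image of [A_i], which contains the kernel of [q],
spans the inverse image. *)
exists O, (fun i => k' i + Adom w i)%N, (fun i z =>
  col_mx (S i (Y z) *m (invmx (T i *m qmx D E (e z) i) *m T i)) (Amap (e z) i)).
split=> //.
- by split=> // i; rewrite T1 unitmx1.
- move=> i; apply: regular_col_mx => //; last first.
    apply: (regular_mx_sub kZ oO oT) => //; exact: regular_Amap.
  apply: regular_mxM => //.
    by apply: (regular_mx_sub kZ oO oU) => // a b; apply: (rU _ (rS i a b)).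
  apply: regular_mxM => //; last exact: regular_mx_cst.
  apply: regular_invmx => //; last by move=> z [].
  exact: (regular_mx_sub kZ oO oT).
move=> z [Vz uz] i; have [_ _ push pull] := slice_reduction i (ge z).
set B := col_mx _ _; have AB : (mximage (Amap (e z) i) <= mximage B)%VS.
  by rewrite mximage_submx /B -addsmxE addsmxSr.
have [_ _ <-] := push _ AB; rewrite XE; congr (_ @^-1: _)%VS.
have [_ AX fX] := pull _ (AY z i).
have AqY : (mximage (Amap (e z) i *m qmx D E (e z) i) <= gsub (Y z i))%VS.
  by rewrite -limg_mximage -[X in (_ <= X)%VS]fX limgS.
rewrite limg_mximage mul_col_mx -!mulmxA mulVmx // mulmx1.
rewrite -(SY (Y z) Vz i) mximage_submx in AqY *.
apply: mximage_eqmx; apply: (eqmx_trans (eqmx_sym (addsmxE _ _))).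
exact/addsmx_idPl.
Qed.

End Family.

End Chart.

(** * The transversal slice *)

Theorem transversal_slice (K : fieldType) (Q : bquiver) (w : wvec Q)
    (v v0 : vert Q -> nat) (p : Ew K w) :
  Ev v p -> Evo v0 p ->
  levec v0 v /\
  exists wp : wvec Q, is_wperp w v0 wp /\
  let vp := subvec v v0 in
  let Up : set (Ew K wp) := Ev vp in
  exists U U0 : set (Ew K w),
    [/\ open_in (Ev v) U, U p, open_in (Evo v0) U0 & U0 p] /\
    [/\ Cstar_invariant U & Cstar_invariant U0] /\
  exists (phi : subsp (pr_inv (v := v) U) ->
                prodsp (subsp U0) (subsp (pr_inv (v := vp) Up)))
         (psi : subsp U -> prodsp (subsp U0) (subsp Up)),
    [/\ is_isomorphism phi, is_isomorphism psi &
        forall z, psi (pr z) = ((phi z).1, pr (phi z).2)] /\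
    (forall z : subsp U, val z = p ->
       val (psi z).1 = p /\ val (psi z).2 = [ffun=> 0]) /\
    (forall u : vert Q -> nat, levec v0 u -> levec u v ->
       psi @` [set z | Evo u (val z)] =
       [set t | Evo (subvec u v0) (val t.2)]).
Proof.
move=> vpp v0p; split; first by move=> i; rewrite -(v0p i); apply: vpp.
have [wp [D [E [wpP gp Cp]]]] := slice_data v0p.
exists wp; split=> // vp Up.
have kEw (w' : wvec Q) : kempf (Ew K w') by apply: kempf_affsp.
have kG (w' : wvec Q) k : kempf (grassmannians K k (Acod w')).
  exact: kempf_grass.
have kEG (w' : wvec Q) k :
    kempf (prodsp (Ew K w') (grassmannians K k (Acod w'))).
  by apply: kempf_prodsp.
pose G : set (Ew K w) := [set e | generic D E e].
have oG : zopen G.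
  have -> : G = [set e | setT e /\ forall i, pivot D E e i \in unitmx].
    by rewrite predeqE => e; split=> [ge|[_ ge]]; [split|].
  apply: open_unitmx; [exact: kEw | exact: kempf_openT | move=> i].
  have mid : is_morphism (X := Ew K w) (Y := Ew K w) id by move=> V oV; split.
  exact: (regular_pivot (kEw w) D E mid).
have CG (c : K) e : c != 0 -> G e -> G [ffun j => c * e j].
  move=> c0 ge i; have := ge i; rewrite /pivot BmxZ -scalemxAr -scalemxAl.
  by rewrite unitmxZ ?unitfE.
have rankC (c : K) (e : {ffun Ecoord w -> K}) i : c != 0 ->
    \rank (Amap [ffun j => c * e j] i) = \rank (Amap e i).
  by move=> c0; rewrite -!rank_Bmx BmxZ mxrank_scale_nz.
pose U := Ev v `&` G; pose U0 := Evo v0 `&` G.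
exists U, U0; split; first by split=> //; exists G.
split.
  by split=> c e c0 [re /(CG c _ c0) ge]; split=> // i; rewrite rankC.
have slUp e : U e -> Up (slice D E e).
  move=> [re ge] i; have := re i; rewrite (rank_slice i ge) /vp /subvec => le.
  by rewrite -(leq_add2l (v0 i)) subnKC // (leq_trans _ le) // leq_addr.
have baseU0 e : U e -> U0 (base D E e).
  move=> [_ ge]; have gb : G (base D E e) by apply: generic_glue.
  by split=> //; apply/Evo_slice0 => //; apply: slice_base.
have sl0 e : U0 e -> slice D E e = 0 by move=> [re ge]; apply/Evo_slice0.
have slK e t : U0 e -> slice D E (glue D E e t) = t.
  by move=> U0e; rewrite slice_glue ?sl0 ?add0r //; case: U0e.
have glueU e t : U0 e -> Up t -> U (glue D E e t).
  move=> U0e tp; have gg : G (glue D E e t) by apply: generic_glue; case: U0e.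
  split=> // i; rewrite (rank_slice i gg) slK //.
  by rewrite -(subnKC (_ : (v0 i <= v i)%N)) ?leq_add2l // -(v0p i); apply: vpp.
have baseK e t : U0 e -> base D E (glue D E e t) = e.
  by move=> U0e; apply: base_glue; [case: U0e | apply: sl0].
have glueK e : U e -> glue D E (base D E e) (slice D E e) = e.
  by move=> [_ ge]; apply: glue_base.
have slp : slice D E p = 0.
  apply: Bmx_eq0 => i; rewrite Bmx_slice /rho mulmxBl Cp sub0r lamE.
  rewrite [_ *m (_ *m star_pivot _ _ _ *m _)]mulmxA.
  by rewrite [_ *m (_ *m star_pivot _ _ _)]mulmxA Cp !mul0mx oppr0 mul0mx.
have basep : base D E p = p by rewrite /base slp oppr0 glue0.
pose psi (z : subsp U) : prodsp (subsp U0) (subsp Up) :=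
  (exist (fun e => e \in U0) _ (mem_set (baseU0 _ (set_valP z))),
   exist (fun e => e \in Up) _ (mem_set (slUp _ (set_valP z)))).
pose psi' (t : prodsp (subsp U0) (subsp Up)) : subsp U :=
  exist (fun e => e \in U) _
    (mem_set (glueU _ _ (set_valP t.1) (set_valP t.2))).
have psiK : cancel psi psi'.
  by move=> z; apply: val_inj; apply: glueK; apply: set_valP.
have psi'K : cancel psi' psi.
  move=> [t1 t2]; congr pair; apply: val_inj => /=.
    by apply: baseK; apply: set_valP.
  by apply: slK; apply: set_valP.
have kU : kempf (subsp U) by apply: kempf_subsp.
have kU0 : kempf (subsp U0) by apply: kempf_subsp.
have kUp : kempf (subsp Up) by apply: kempf_subsp.
have ipsi : is_isomorphism psi.
  split.
    have mv := @morphism_val _ (Ew K w) U.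
    have ge (z : subsp U) : generic D E (val z) by case: (set_valP z).
    apply: morphism_pair => //; apply: morphism_subsp => //.
      exact: morphism_base.
    exact: morphism_slice.
  exists psi'; split=> //; have kP := kempf_prodsp kU0 kUp.
  have m1 := morphism_comp (morphism_fst kU0 kUp) (@morphism_val _ _ U0).
  have m2 := morphism_comp (morphism_snd kU0 kUp) (@morphism_val _ _ Up).
  apply: morphism_subsp => //; apply: (morphism_glue kP m1 _ m2) => t.
  by case: (set_valP t.1).
(* On the first factor [phi] is [psi]; on flags it takes images under the
projections [f e i], and its inverse takes inverse images under the projections
at the glued point. *)
have reduce e : U e -> forall i, schur_reduction (v0 i) (Amap e i)
    (qmx D E e i) (Amap (slice D E e) i).
  by move=> [_ ge] i; apply: slice_reduction.
pose f e i := linfun (mulmxr (qmx D E e i) :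
  'rV[K]_(Acod w i) -> 'rV[K]_(Acod wp i)).
have subK i : (v0 i <= v i)%N by rewrite -(v0p i); apply: vpp.
have flagP (z : subsp (pr_inv (v := v) U)) : [/\ U (val z).1,
    arrow_stable (fun i => gsub ((val z).2 i)) &
    forall i, (mximage (Amap (val z).1 i) <= gsub ((val z).2 i))%VS].
  by have [[zF zA] zU] := set_valP z; split.
have pushdim (z : subsp (pr_inv (v := v) U)) i :
    \dim (f (val z).1 i @: gsub ((val z).2 i))%VS == vp i.
  have [Uz _ AX] := flagP z; have [_ _ push _] := reduce _ Uz i.
  have [dX _ _] := push _ (AX i).
  by rewrite -(eqn_add2l (v0 i)) -dX subnKC //; apply: svalP ((val z).2 i).
pose push (z : subsp (pr_inv (v := v) U)) :
    prodsp (Ew K wp) (grassmannians K vp (Acod wp)) :=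
  (slice D E (val z).1, fun i =>
    exist (fun X : {vspace 'rV[K]_(Acod wp i)} => \dim X == vp i) _
      (pushdim z i)).
have pushP z : push z \in pr_inv (v := vp) Up.
  apply: mem_set; have [Uz sX AX] := flagP z.
  split; last exact: (slUp _ Uz); split=> [b u uX h|i].
    have ge : generic D E (val z).1 by case: Uz.
    by have [+ _] := arrow_stable_push ge AX; apply.
  by have [_ _ pushX _] := reduce _ Uz i; case: (pushX _ (AX i)).
have flagP' (t : subsp (pr_inv (v := vp) Up)) : [/\ Up (val t).1,
    arrow_stable (fun i => gsub ((val t).2 i)) &
    forall i, (mximage (Amap (val t).1 i) <= gsub ((val t).2 i))%VS].
  by have [[tF tA] tU] := set_valP t; split.
have pullP (t : prodsp (subsp U0) (subsp (pr_inv (v := vp) Up))) :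
    let e := glue D E (val t.1) (val t.2).1 in
    [/\ U e, generic D E e, slice D E e = (val t.2).1 & forall i,
      (mximage (Amap (slice D E e) i) <= gsub ((val t.2).2 i))%VS].
  move=> e; have [Ut _ AY] := flagP' t.2; have U0t := set_valP t.1.
  have Ue : U e by exact: (glueU _ _ U0t Ut).
  have sle : slice D E e = (val t.2).1 by apply: slK.
  by split=> //; [case: Ue | rewrite sle].
have pulldim (t : prodsp (subsp U0) (subsp (pr_inv (v := vp) Up))) i :
    \dim (f (glue D E (val t.1) (val t.2).1) i @^-1: gsub ((val t.2).2 i))%VS
      == v i.
  have [Ue _ _ AY] := pullP t; have [_ _ _ pull] := reduce _ Ue i.
  have [-> _ _] := pull _ (AY i).
  by rewrite (eqP (svalP ((val t.2).2 i))) /vp /subvec subnKC.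
pose pull (t : prodsp (subsp U0) (subsp (pr_inv (v := vp) Up))) :
    prodsp (Ew K w) (grassmannians K v (Acod w)) :=
  (glue D E (val t.1) (val t.2).1, fun i =>
    exist (fun X : {vspace 'rV[K]_(Acod w i)} => \dim X == v i) _
      (pulldim t i)).
have pullP2 t : pull t \in pr_inv (v := v) U.
  apply: mem_set; have [Ue ge sle AY] := pullP t.
  have [_ sY _] := flagP' t.2.
  have AX i : (mximage (Amap (pull t).1 i) <= gsub ((pull t).2 i))%VS.
    by have [_ _ _ pullY] := reduce _ Ue i; case: (pullY _ (AY i)).
  have fX i : (f (pull t).1 i @: gsub ((pull t).2 i))%VS = gsub ((val t.2).2 i).
    by have [_ _ _ pullY] := reduce _ Ue i; case: (pullY _ (AY i)).
  split=> //; split=> //; apply/(arrow_stable_push ge AX) => b u.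
  by rewrite fX => uY h; rewrite fX; apply: sY.
pose phi (z : subsp (pr_inv (v := v) U)) :
    prodsp (subsp U0) (subsp (pr_inv (v := vp) Up)) :=
  ((psi (pr z)).1, exist (fun t => t \in pr_inv (v := vp) Up) _ (pushP z)).
pose phi' (t : prodsp (subsp U0) (subsp (pr_inv (v := vp) Up))) :
    subsp (pr_inv (v := v) U) :=
  exist (fun z => z \in pr_inv (v := v) U) _ (pullP2 t).
have phiK : cancel phi phi'.
  move=> z; apply: val_inj; have [Uz sX AX] := flagP z.
  have e1 : (val (phi' (phi z))).1 = (val z).1 by apply: glueK.
  apply: injective_projections => //; apply: grass_eq => i.
  rewrite [LHS]/= -/(f _ i) [glue _ _ _ _]e1.
  by have [_ _ pushX _] := reduce _ Uz i; case: (pushX _ (AX i)).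
have phi'K : cancel phi' phi.
  move=> t; have U0t := set_valP t.1; have [Ue _ sle AY] := pullP t.
  rewrite [RHS]surjective_pairing; congr pair; apply: val_inj.
    by apply: baseK.
  apply: injective_projections; first exact: sle.
  apply: grass_eq => i.
  by have [_ _ _ pullY] := reduce _ Ue i; case: (pullY _ (AY i)).
have kX : kempf (subsp (pr_inv (v := v) U)) by apply: kempf_subsp.
have kY : kempf (subsp (pr_inv (v := vp) Up)) by apply: kempf_subsp.
have iphi : is_isomorphism phi.
  split.
    have mv := @morphism_val _ _ (pr_inv (v := v) U).
    have m1 := morphism_comp mv (morphism_fst (kEw w) (kG w v)).
    have m2 := morphism_comp mv (morphism_snd (kEw w) (kG w v)).
    have ge (z : subsp (pr_inv (v := v) U)) : generic D E (val z).1.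
      by have [[]] := flagP z.
    apply: morphism_pair => //; apply: morphism_subsp => //.
      exact: (morphism_base kX m1 ge).
    apply: morphism_pair => //; first exact: (morphism_slice kX m1 ge).
    by apply: (morphism_push kX m1 ge m2).
  exists phi'; split=> //; have kP := kempf_prodsp kU0 kY.
  have m1 := morphism_comp (morphism_fst kU0 kY) (@morphism_val _ _ U0).
  have m2 := morphism_comp (morphism_snd kU0 kY)
    (@morphism_val _ _ (pr_inv (v := vp) Up)).
  have m3 := morphism_comp m2 (morphism_fst (kEw wp) (kG wp vp)).
  have m4 := morphism_comp m2 (morphism_snd (kEw wp) (kG wp vp)).
  have ge0 (t : prodsp (subsp U0) (subsp (pr_inv (v := vp) Up))) :
    generic D E (val t.1) by case: (set_valP t.1).
  have mg := morphism_glue kP m1 ge0 m3.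
  apply: morphism_subsp => //; apply: morphism_pair => //.
  have ge t : generic D E (pull t).1 by have [] := pullP t.
  apply: (morphism_pull kP mg ge m4) => // t i.
  by have [_ _ _ AY] := pullP t; apply: AY.
exists phi, psi; split; [split=> // z | split=> [z zp | u v0u uv]].
- by congr pair; apply: val_inj.
- by rewrite /= zp basep slp; split=> //; apply/ffunP => j; rewrite !ffunE.
- rewrite predeqE => t; split=> [[z uz <-] i|ut].
    have [_ ge] := set_valP z.
    by rewrite /= /subvec -(uz i) (rank_slice i ge) addKn.
  exists (psi' t); last exact: psi'K.
  have U0t := set_valP t.1; have [_ gg] := glueU _ _ U0t (set_valP t.2).
  by move=> i; rewrite /= (rank_slice i gg) slK // (ut i) /subvec subnKC.
Qed.

Theorem lemma4p3 (R : realType) (Q : bquiver) (w : wvec Q)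
    (v v0 : vert Q -> nat) (p : Ew R[i] w) :
  Ev v p -> Evo v0 p ->
  levec v0 v /\
  exists wp : wvec Q, is_wperp w v0 wp /\
  let vp := subvec v v0 in
  let Up : set (Ew R[i] wp) := Ev vp in
  exists U U0 : set (Ew R[i] w),
    [/\ open_in (Ev v) U, U p, open_in (Evo v0) U0 & U0 p] /\
    [/\ Cstar_invariant U & Cstar_invariant U0] /\
  exists (phi : subsp (pr_inv (v := v) U) ->
                prodsp (subsp U0) (subsp (pr_inv (v := vp) Up)))
         (psi : subsp U -> prodsp (subsp U0) (subsp Up)),
    [/\ is_isomorphism phi, is_isomorphism psi &
        forall z, psi (pr z) = ((phi z).1, pr (phi z).2)] /\
    (forall z : subsp U, val z = p ->
       val (psi z).1 = p /\ val (psi z).2 = [ffun=> 0]) /\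
    (forall u : vert Q -> nat, levec v0 u -> levec u v ->
       psi @` [set z | Evo u (val z)] =
       [set t | Evo (subvec u v0) (val t.2)]).
Proof. exact: transversal_slice. Qed.
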